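(* Consider SPDHG (as in the context) run with step-sizes $\beta^{k+1} = \frac{1}{\sqrt{k+1}+L}$ and uniform weights $\alpha^{k+1}=\frac{1}{t+1}$, $k=0,\dots,t$. Let $(y^*,x^* )$ be any saddle point of $\min_{x\in\mathcal{X}}\max_{y\in\mathcal{Y}}P(y,x)$. Then for every $\Omega>0$ and $t\ge0$, $$\mathrm{Prob}\left(P(y^*,\bar{x}^t) - P(\bar{y}^t,x^* ) > \frac{D_y^2}{2s(t+1)} + \frac{L D_x^2}{2(t+1)} + \frac{D_x^2+2\lambda_{\max}(F^\top F)D_y^2}{\sqrt{t+1}} + \frac{2\sqrt{\Omega} D_x \sigma}{\sqrt{t+1}} + \frac{(1+\Omega) \sigma^2}{\sqrt{t+1}}\right)\leq 2\exp(-\Omega).$$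
   Context: Setting: $\mathcal{X}\subset\mathbb{R}^d$ is a nonempty convex compact set with diameter $D_x$ (so $\|x-x'\|\le D_x$ for all $x,x'\in\mathcal{X}$), $\mathcal{Y}\subset\mathbb{R}^l$ is a nonempty convex compact set with diameter $D_y$, $F\in\mathbb{R}^{l\times d}$, and $\lambda_{\max}(F^\top F)$ denotes the largest eigenvalue of $F^\top F$. The loss is $l(x)=\mathbb{E}_\xi[l(x,\xi)]$, a convex, continuously differentiable function on $\mathcal{X}$ with $L$-Lipschitz gradient: $\|\nabla l(x_1)-\nabla l(x_2)\|\le L\|x_1-x_2\|$ for all $x_1,x_2\in\mathcal{X}$. The stochastic gradient $\nabla l(x,\xi)$ satisfies, for every $x\in\mathcal{X}$: $\mathbb{E}[\nabla l(x,\xi)]=\nabla l(x)$, $\mathbb{E}\|\nabla l(x,\xi)-\nabla l(x)\|^2\le\sigma^2$, and $\mathbb{E}\exp\left(\|\nabla l(x,\xi)-\nabla l(x)\|^2/\sigma^2\right)\le \exp(1)$, for a constant $\sigma>0$. The saddle function is $P(y,x)=l(x)+\langle y,Fx\rangle$ for $x\in\mathcal{X},y\in\mathcal{Y}$; a saddle point $(y^*,x^* )$ satisfies $P(y,x^* )\le P(y^*,x^* )\le P(y^*,x)$ for all $(y,x)\in\mathcal{Y}\times\mathcal{X}$ (assumed to exist). SPDHG: fix $s>0$, $x^0\in\mathcal{X}$, $y^0\in\mathcal{Y}$, and a sequence of step-sizes $\beta^{k+1}>0$. For $k=0,1,2,\dots$, draw a sample $\xi^{k+1}$ independently of the past (i.i.d.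 samples), and set $$y^{k+1}=\arg\max_{y\in\mathcal{Y}}\Big\{P(y,x^k)-\tfrac{1}{2s}\|y-y^k\|^2\Big\},\qquad x^{k+1}=\Pi_{\mathcal{X}}\Big[x^k-\beta^{k+1}\big(\nabla l(x^k,\xi^{k+1})+F^\top y^{k+1}\big)\Big],$$ where $\Pi_{\mathcal{X}}$ is Euclidean projection onto $\mathcal{X}$. Given weights $\alpha^{k+1}\ge0$ with $\sum_{k=0}^t\alpha^{k+1}=1$, the output after $t$ steps is $\bar x^t=\sum_{k=0}^t\alpha^{k+1}x^{k+1}$, $\bar y^t=\sum_{k=0}^t\alpha^{k+1}y^{k+1}$. *)

(* Defs.v *)
From HB Require Import structures.
From mathcomp Require Import all_boot all_order all_algebra.
From mathcomp Require Import all_classical all_reals all_analysis.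
Set Implicit Arguments. Unset Strict Implicit. Unset Printing Implicit Defensive.
Import Order.TTheory GRing.Theory Num.Theory.
Import numFieldNormedType.Exports.
Local Open Scope classical_set_scope.
Local Open Scope ring_scope.

Definition dotv {R : realType} {n : nat} (u v : 'cV[R]_n) : R :=
  \sum_(i < n) u i 0 * v i 0.

Definition normv {R : realType} {n : nat} (u : 'cV[R]_n) : R :=
  Num.sqrt (dotv u u).

Definition cvx_set {R : realType} {n : nat} (C : set 'cV[R]_n) : Prop :=
  forall u v, C u -> C v -> forall t : R, 0 <= t <= 1 ->
    C (t *: u + (1 - t) *: v).

Definition diam {R : realType} {n : nat} (C : set 'cV[R]_n) : R :=
  sup [set r | exists u v, C u /\ C v /\ r = normv (u - v)].

Definition lambda_max {R : realType} {n : nat} (A : 'M[R]_n) : R :=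
  sup [set a | eigenvalue A a].

Definition cvx_fun_on {R : realType} {n : nat} (C : set 'cV[R]_n)
  (f : 'cV[R]_n -> R) : Prop :=
  forall u v, C u -> C v -> forall t : R, 0 <= t <= 1 ->
    f (t *: u + (1 - t) *: v) <= t * f u + (1 - t) * f v.

Definition has_gradient_on {R : realType} {n : nat} (C : set 'cV[R]_n)
  (f : 'cV[R]_n -> R) (g : 'cV[R]_n -> 'cV[R]_n) : Prop :=
  forall x, C x -> differentiable f x /\ forall h, 'd f x h = dotv (g x) h.

Definition lipschitz_grad_on {R : realType} {n : nat} (C : set 'cV[R]_n)
  (g : 'cV[R]_n -> 'cV[R]_n) (L : R) : Prop :=
  forall x1 x2, C x1 -> C x2 -> normv (g x1 - g x2) <= L * normv (x1 - x2).

Definition saddleP {R : realType} {d l : nat} (F : 'M[R]_(l, d))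
  (loss : 'cV[R]_d -> R) (y : 'cV[R]_l) (x : 'cV[R]_d) : R :=
  loss x + dotv y (F *m x).

(* p is the Euclidean projection of z onto C (it is unique for closed
   convex nonempty C). *)
Definition is_proj {R : realType} {n : nat} (C : set 'cV[R]_n) (z p : 'cV[R]_n)
  : Prop := C p /\ forall q, C q -> normv (p - z) <= normv (q - z).

Definition is_argmax {R : realType} {n : nat} (C : set 'cV[R]_n)
  (phi : 'cV[R]_n -> R) (p : 'cV[R]_n) : Prop :=
  C p /\ forall q, C q -> phi q <= phi p.

Definition vec_of_tuple {R : realType} {n : nat} (t : n.-tuple R) : 'cV[R]_n :=
  \col_(i < n) tnth t i.

Definition mutually_independent {dT dX : measure_display} {T : measurableType dT}
  {X : measurableType dX} {R : realType} (P : probability T R)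
  (xi : nat -> T -> X) : Prop :=
  forall (s : seq nat) (A : nat -> set X), uniq s ->
    (forall j, measurable (A j)) ->
    P (\big[setI/setT]_(j <- s) (xi j @^-1` A j)) =
    (\prod_(j <- s) P (xi j @^-1` A j))%E.

Definition identically_distributed {dT dX : measure_display}
  {T : measurableType dT} {X : measurableType dX} {R : realType}
  (P : probability T R) (xi : nat -> T -> X) : Prop :=
  forall k (A : set X), measurable A -> P (xi k @^-1` A) = P (xi 0%N @^-1` A).

(* Main.v *)
Require Import Defs.
From HB Require Import structures.
From mathcomp Require Import all_boot all_order all_algebra.
From mathcomp Require Import all_classical all_reals all_analysis.
From mathcomp Require Import measurable_realfun.
From mathcomp Require Import ring lra.
Import Order.TTheory GRing.Theory Num.Theory.
Import numFieldNormedType.Exports.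
Local Open Scope classical_set_scope.
Local Open Scope ring_scope.

(* Write [a_k = sqrt(k+1)], [N = t+1], [dl_k] for the gradient noise at step [k]
   and [r_k = F^T (y_{k+1} - ystar)], so that [|r_k| <= q := sqrt(lam) Dy].  The
   variational inequalities of both projection steps, the descent lemma and
   convexity of the loss give, after summation by parts, the pathwise bound
     N gap <= (sqrt N + L) Dx^2 / 2 + Dy^2 / (2 s)
              + sum_k <dl_k, xstar - x_k> + sum_k |dl_k + r_k|^2 / (2 a_k).
   The noise enters only through a sum [sum_k <dl_k, u_k>] with predictable [u_k]
   and through [sum_k |dl_k|^2 / a_k].  Conditionally on the past (Fubini for the
   product law of the past and the fresh sample) the exponential moments of each
   term are controlled, so each sum exceeds its threshold with probability at
   most [exp(-Om)].
   The constants force two treatments of the cross term [<dl_k, r_k> / a_k].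
   For [Om >= 1] Young's inequality suffices, as [sum_k 1/a_k <= 2 sqrt N - 1].
   For [Om <= 1] it would double the coefficient of [|dl_k|^2]; but [y_{k+1}] is
   computed before the sample is drawn, so [r_k] is predictable and the cross term
   joins the martingale, with [u_k = xstar - x_k + r_k / a_k]. *)

(** * Euclidean geometry *)

Section euclidean.
Context {R : realType}.

Section fixed_dim.
Context {n : nat}.
Implicit Types (u v w : 'cV[R]_n) (a b : R).

Lemma dotvC u v : dotv u v = dotv v u.
Proof. by apply: eq_bigr => i _; rewrite mulrC. Qed.

Lemma dotvDl u v w : dotv (u + v) w = dotv u w + dotv v w.
Proof. by rewrite -big_split; apply: eq_bigr => i _; rewrite mxE mulrDl. Qed.

Lemma dotvZl a u v : dotv (a *: u) v = a * dotv u v.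
Proof. by rewrite mulr_sumr; apply: eq_bigr => i _; rewrite mxE mulrA. Qed.

Lemma dotvDr u v w : dotv u (v + w) = dotv u v + dotv u w.
Proof. by rewrite dotvC dotvDl !(dotvC u). Qed.

Lemma dotvZr a u v : dotv u (a *: v) = a * dotv u v.
Proof. by rewrite dotvC dotvZl (dotvC u). Qed.

Lemma dotvNl u v : dotv (- u) v = - dotv u v.
Proof. by rewrite -scaleN1r dotvZl mulN1r. Qed.

Lemma dotvNr u v : dotv u (- v) = - dotv u v.
Proof. by rewrite dotvC dotvNl dotvC. Qed.

Definition dotvE := (dotvDl, dotvDr, dotvNl, dotvNr, dotvZl, dotvZr).

Lemma dotv0 u : dotv u 0 = 0.
Proof. by rewrite -(scale0r u) dotvZr mul0r. Qed.

Lemma dotv_sumr (I : Type) (r : seq I) (f : I -> 'cV[R]_n) u :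
  dotv u (\sum_(i <- r) f i) = \sum_(i <- r) dotv u (f i).
Proof.
by elim/big_rec2: _ => [|i a b _ <-]; rewrite ?dotv0 // dotvDr.
Qed.

Lemma dotvv_ge0 u : 0 <= dotv u u.
Proof. by apply: sumr_ge0 => i _; rewrite -expr2 sqr_ge0. Qed.

Lemma dotvv_eq0 u : dotv u u = 0 -> u = 0.
Proof.
move=> /psumr_eq0P u0; apply/colP => i; rewrite mxE; apply/eqP.
by rewrite -sqrf_eq0 expr2 u0 // => j _; rewrite -expr2 sqr_ge0.
Qed.

Lemma normv_ge0 u : 0 <= normv u.
Proof. exact: sqrtr_ge0. Qed.

Lemma sqr_normv u : normv u ^+ 2 = dotv u u.
Proof. by rewrite sqr_sqrtr // dotvv_ge0. Qed.

Lemma normv0 : normv (0 : 'cV[R]_n) = 0.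
Proof. by rewrite /normv dotv0 sqrtr0. Qed.

Lemma normv_eq0 u : normv u = 0 -> u = 0.
Proof. by move=> u0; apply: dotvv_eq0; rewrite -sqr_normv u0 expr0n. Qed.

Lemma normvN u : normv (- u) = normv u.
Proof. by rewrite /normv !dotvE opprK. Qed.

Lemma normvZ a u : normv (a *: u) = `|a| * normv u.
Proof. by rewrite /normv !dotvE mulrA -expr2 sqrtrM ?sqr_ge0 // sqrtr_sqr. Qed.

Lemma dotv_le_normv u v : dotv u v <= normv u * normv v.
Proof.
have [v0|vn0] := eqVneq (normv v) 0.
  by rewrite (normv_eq0 _ v0) dotv0 normv0 mulr0.
have vgt0 : 0 < normv v by rewrite lt0r vn0 normv_ge0.
have [u0|un0] := eqVneq (normv u) 0.
  by rewrite (normv_eq0 _ u0) dotvC dotv0 normv0 mul0r.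
have ugt0 : 0 < normv u by rewrite lt0r un0 normv_ge0.
have := dotvv_ge0 (normv v *: u - normv u *: v).
rewrite !dotvE -!sqr_normv (dotvC v u).
set a := normv u; set b := normv v; set c := dotv u v => H.
have : 0 <= (a * b) * (a * b - c) by nra.
by rewrite pmulr_rge0 ?mulr_gt0 // subr_ge0.
Qed.

Lemma sqr_normvD u v :
  normv (u + v) ^+ 2 = normv u ^+ 2 + 2 * dotv u v + normv v ^+ 2.
Proof. by rewrite !sqr_normv !dotvE (dotvC v u); ring. Qed.

Lemma normr_dotv_le u v : `|dotv u v| <= normv u * normv v.
Proof.
rewrite ler_norml dotv_le_normv andbT lerNl -dotvNl -(normvN u).
exact: dotv_le_normv.
Qed.

Lemma normvD u v : normv (u + v) <= normv u + normv v.
Proof.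
rewrite -(ler_pXn2r (ltn0Sn 1)) ?nnegrE ?addr_ge0 ?normv_ge0 //.
rewrite sqr_normv !dotvE -!sqr_normv (dotvC v u).
by have := dotv_le_normv u v; nra.
Qed.

Lemma normr_coord_le_normv u i : `|u i 0| <= normv u.
Proof.
rewrite -(ler_pXn2r (ltn0Sn 1)) ?nnegrE ?normv_ge0 // sqr_normv real_normK ?num_real //.
rewrite /dotv (bigD1 i) //= expr2 lerDl.
by apply: sumr_ge0 => j _; rewrite -expr2 sqr_ge0.
Qed.

Lemma normr_coord_le_mx_norm u i : `|u i 0| <= `|u|.
Proof.
rewrite [leRHS]/Num.norm /= mx_normrE; apply/bigmax_geP; right => /=.
by exists (i, 0).
Qed.

Lemma normv_le_mx_norm u : normv u <= n%:R * `|u|.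
Proof.
rewrite -(ler_pXn2r (ltn0Sn 1)) ?nnegrE ?mulr_ge0 ?normv_ge0 //.
rewrite sqr_normv.
apply: (@le_trans _ _ (\sum_(i < n) `|u| ^+ 2)).
  apply: ler_sum => i _; rewrite -expr2 -real_normK ?num_real //.
  by rewrite ler_pXn2r ?nnegrE // normr_coord_le_mx_norm.
rewrite sumr_const card_ord exprMn -[leLHS]mulr_natl ler_wpM2r ?sqr_ge0 //.
by rewrite -natrX ler_nat; case: n => // k; rewrite expnS leq_pmulr.
Qed.

Lemma mx_norm_le_normv u : `|u| <= normv u.
Proof.
rewrite {1}/Num.norm /= mx_normrE; apply/bigmax_leP; split => [|[i j] _ /=].
  exact: normv_ge0.
by rewrite ord1 normr_coord_le_normv.
Qed.

End fixed_dim.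

Lemma dotv_mulmx {m n} (A : 'M[R]_(m, n)) u v :
  dotv u (A *m v) = dotv (A^T *m u) v.
Proof.
rewrite /dotv.
under eq_bigr do rewrite mxE mulr_sumr.
rewrite exchange_big /=; apply: eq_bigr => j _.
rewrite mxE mulr_suml; apply: eq_bigr => i _.
by rewrite mxE mulrCA mulrA.
Qed.

(** The topology on matrices comes from the max norm, so the Euclidean Lipschitz bound is
    transferred through [|u| <= normv u <= n * |u|]. *)
Lemma lipschitz_normv_continuous {m n} (f : 'cV[R]_m -> 'cV[R]_n) (C : R) :
  0 <= C ->
  (forall z z', normv (f z - f z') <= C * normv (z - z')) -> continuous f.
Proof.
move=> C0 fC z; apply/(@cvgrPdist_lt _ _ _ _ (nbhs_filter z)) => e e0.
near=> z'.
apply: le_lt_trans (mx_norm_le_normv _) _.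
apply: le_lt_trans (fC _ _) _.
apply: (@le_lt_trans _ _ ((C * m%:R + 1) * `|z - z'|)).
  rewrite mulrDl mul1r -mulrA; apply: ler_wpDr => //.
  by rewrite ler_wpM2l // normv_le_mx_norm.
rewrite -ltr_pdivlMl; last by rewrite ltr_wpDl // mulr_ge0.
near: z'; apply: cvgr_dist_lt => //.
by rewrite mulr_gt0 // invr_gt0 ltr_wpDl // mulr_ge0.
Unshelve. all: by end_near. Qed.

Lemma dotvv_continuous {n} (z : 'cV[R]_n) :
  continuous (fun v : 'cV[R]_n => dotv (v - z) (v - z)).
Proof.
apply: (continuous_big (op := +%R)) => [|i _]; first exact: add_continuous.
have c : continuous (fun u : 'cV[R]_n => (u - z) i 0 : R).
  move=> v; under eq_fun do rewrite mxE.
  by apply: continuousD; [exact: coord_continuous|exact: cst_continuous].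
by move=> v; apply: continuousM; exact: c.
Qed.

End euclidean.

(** * Projections and smooth convex functions *)

Section projection.
Context {R : realType} {n : nat}.
Implicit Types (C : set 'cV[R]_n) (z p q : 'cV[R]_n).

(** First-order optimality in one variable, used for projections and for the Rayleigh quotient. If
    [a < 0], the choice [t = - a / (2 * (|b| - a))] gives [t * |b| <= - a / 2], so [a + t * b] is
    negative. *)
Lemma ge0_of_quadratic_ge0 (a b : R) :
  (forall t, 0 < t -> t <= 1 -> 0 <= t * a + t ^+ 2 * b) -> 0 <= a.
Proof.
move=> H; rewrite leNgt; apply/negP => a0.
pose c := `|b| - a.
have b0 : 0 <= `|b| by [].
have bb : b <= `|b| by exact: ler_norm.
have c0 : 0 < c by rewrite /c; lra.
have t0 : 0 < - a / (2 * c) by rewrite divr_gt0 ?oppr_gt0 ?mulr_gt0.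
have tE : - a / (2 * c) * (2 * c) = - a by field; rewrite gt_eqF.
have t1 : - a / (2 * c) <= 1 by rewrite ler_pdivrMr ?mulr_gt0 //; rewrite /c; lra.
have := H _ t0 t1; set t := - a / (2 * c) in t0 t1 tE *.
have -> : t * a + t ^+ 2 * b = t * (a + t * b) by ring.
rewrite pmulr_rge0 //.
have : t * b <= t * `|b| by rewrite ler_wpM2l // ltW.
have : t * a < 0 by rewrite pmulr_rlt0.
rewrite /c in tE; nra.
Qed.

(** The segment from [p] to [q] stays in [C], and along it the derivative at [p] of the squared
    distance to [z] cannot be negative. *)
Lemma is_proj_variational {C z p q} : cvx_set C -> is_proj C z p -> C q ->
  0 <= dotv (p - z) (q - p).
Proof.
move=> Ccvx [Cp pmin] Cq.
suff : 0 <= 2 * dotv (p - z) (q - p) by rewrite pmulr_rge0.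
apply: (@ge0_of_quadratic_ge0 _ (normv (q - p) ^+ 2)) => t t0 t1.
have := pmin _ (Ccvx q p Cq Cp t _); rewrite (ltW t0) t1 => /(_ isT).
rewrite -(ler_pXn2r (ltn0Sn 1)) ?nnegrE ?normv_ge0 //.
have -> : t *: q + (1 - t) *: p - z = (p - z) + t *: (q - p).
  by apply/colP => i; rewrite !mxE; ring.
rewrite (sqr_normvD (p - z)) normvZ dotvZr exprMn real_normK ?num_real //; lra.
Qed.

(** Adding the variational inequality of [p] tested at [p'] to that of [p'] tested at [p] gives
    [|p - p'|^2 <= <z - z', p - p'>]; Cauchy-Schwarz concludes. *)
Lemma is_proj_nonexpansive {C z z' p p'} : cvx_set C ->
  is_proj C z p -> is_proj C z' p' -> normv (p - p') <= normv (z - z').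
Proof.
move=> Ccvx pp pp'.
have h1 := is_proj_variational Ccvx pp pp'.1.
have h2 := is_proj_variational Ccvx pp' pp.1.
have h : normv (p - p') ^+ 2 <= normv (z - z') * normv (p - p').
  apply: le_trans (dotv_le_normv _ _).
  rewrite sqr_normv; move: h1 h2.
  by rewrite !dotvE !(dotvC p' p); lra.
have [->|p0] := eqVneq (normv (p - p')) 0; first exact: normv_ge0.
by move: h; rewrite expr2 ler_pM2r // lt0r p0 normv_ge0.
Qed.

Lemma is_proj_unique {C z p p'} : cvx_set C ->
  is_proj C z p -> is_proj C z p' -> p = p'.
Proof.
move=> Ccvx pp pp'; apply/eqP; rewrite -subr_eq0; apply/eqP/normv_eq0/eqP.
rewrite eq_le normv_ge0 andbT.
by have := is_proj_nonexpansive Ccvx pp pp'; rewrite subrr normv0.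
Qed.

Lemma is_proj_exists C z : C !=set0 -> compact C -> exists p, is_proj C z p.
Proof.
move=> C0 cC.
have [|p pC pmin] := @compact_EVT_min _ R
  (fun v : 'cV[R]_n => dotv (v - z) (v - z)) _ C0 cC.
  exact/continuous_subspaceT/dotvv_continuous.
exists p; split; first exact: set_mem.
by move=> q /mem_set /pmin; rewrite ler_sqrt // dotvv_ge0.
Qed.

(** A total function, with value [0] where no nearest point exists. Its continuity makes the
    iterates measurable and extends the loss and its gradient continuously off [X]. *)
Definition proj_onto C z : 'cV[R]_n := xget 0 [set p | is_proj C z p].

Lemma proj_ontoP C z : C !=set0 -> compact C -> is_proj C z (proj_onto C z).
Proof. by move=> C0 cC; apply: (xgetPex 0); exact: is_proj_exists. Qed.

Lemma proj_onto_continuous C : C !=set0 -> compact C -> cvx_set C ->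
  continuous (proj_onto C).
Proof.
move=> C0 cC Ccvx; apply: (@lipschitz_normv_continuous _ _ _ _ 1) => // z z'.
by rewrite mul1r; apply: (is_proj_nonexpansive Ccvx); exact: proj_ontoP.
Qed.

Lemma proj_onto_id C z : cvx_set C -> C z -> proj_onto C z = z.
Proof.
move=> Ccvx Cz.
have zz : is_proj C z z by split => // q _; rewrite subrr normv0 normv_ge0.
have : is_proj C z (proj_onto C z) by apply: (xgetPex 0); exists z.
by move=> h; exact: is_proj_unique h zz.
Qed.

(** Completing the square: up to a constant and the factor [- 1 / (2 s)], the objective is the
    squared distance to [y + s b]. The dual step thus becomes a projection. *)
Lemma is_argmax_is_proj {C} (s c : R) (b y p : 'cV[R]_n) : 0 < s ->
  is_argmax C (fun v => c + dotv v b - (2 * s)^-1 * normv (v - y) ^+ 2) p ->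
  is_proj C (y + s *: b) p.
Proof.
move=> s0 [Cp pmax]; split => // q Cq; have := pmax _ Cq => {}pmax.
rewrite -(ler_pXn2r (ltn0Sn 1)) ?nnegrE ?normv_ge0 //.
have E v : normv (v - (y + s *: b)) ^+ 2 =
   s ^+ 2 * dotv b b + 2 * s * dotv y b
     - 2 * s * (dotv v b - (2 * s)^-1 * normv (v - y) ^+ 2).
  have -> : v - (y + s *: b) = (v - y) - s *: b.
    by apply/colP => i; rewrite !mxE; ring.
  rewrite (sqr_normvD (v - y)) normvN normvZ exprMn real_normK ?num_real //.
  rewrite dotvNr dotvZr dotvDl dotvNl (sqr_normv b).
  by field; rewrite gt_eqF.
rewrite !E lerD2l lerN2 ler_pM2l ?mulr_gt0 //.
by move: pmax; rewrite -!addrA lerD2l.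
Qed.

End projection.

(** * Gradient inequalities and averages for convex functions *)

Section convex.
Context {R : realType} {n : nat}.
Implicit Types (C : set 'cV[R]_n) (f : 'cV[R]_n -> R).

Lemma is_derive_line {C f g} (x h : 'cV[R]_n) (t : R) :
  has_gradient_on C f g -> C (x + t *: h) ->
  is_derive t 1 (fun s : R => f (x + s *: h)) (dotv (g (x + t *: h)) h).
Proof.
move=> fg Cx; have [df dE] := fg _ Cx.
have E : (fun s : R => s^-1 *: (f (x + (s *: 1 + t) *: h) - f (x + t *: h)))
  = (fun s : R => s^-1 *: (f (s *: h + (x + t *: h)) - f (x + t *: h))).
  apply/funext => s; congr (_ *: (f _ - _)).
  by apply/colP => i; rewrite !mxE -[s *: 1]/(s * 1); ring.
apply: DeriveDef.
  have := @diff_derivable _ _ _ f (x + t *: h) h df.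
  by rewrite /derivable /= E.
by rewrite -dE -deriveE // /derive /= E.
Qed.

Lemma convex_gradient_le {C f g} x z : cvx_set C -> cvx_fun_on C f ->
  has_gradient_on C f g -> C x -> C z ->
  f x + dotv (g x) (z - x) <= f z.
Proof.
move=> Ccvx fcvx fg Cx Cz; rewrite -lerBrDl.
have [df dE] := fg _ Cx.
rewrite -dE -deriveE //.
have := cvg_dnbhs_at_right (@diff_derivable _ _ _ f x (z - x) df).
rewrite -/(derive f x (z - x)) => cv.
apply: (cvgr_to_le cv); near=> t.
have t0 : 0 < t by near: t; exact: nbhs_right_gt.
have t1 : t <= 1 by near: t; exact: nbhs_right_le.
rewrite /= [_ *: _]mulrC ler_pdivrMr //.
have -> : t *: (z - x) + x = t *: z + (1 - t) *: x.
  by apply/colP => i; rewrite !mxE; ring.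
have := fcvx z x Cz Cx t; rewrite (ltW t0) t1 => /(_ isT).
by nra.
Unshelve. all: by end_near. Qed.

Lemma descent_lemma {C f g} (L : R) x z : cvx_set C ->
  has_gradient_on C f g -> lipschitz_grad_on C g L -> C x -> C z ->
  f z <= f x + dotv (g x) (z - x) + L / 2 * normv (z - x) ^+ 2.
Proof.
move=> Ccvx fg gL Cx Cz.
pose h : 'cV[R]_n := z - x.
have Cl (t : R) : t \in `[0, 1]%R -> C (x + t *: h).
  rewrite in_itv /= => t01.
  have -> : x + t *: h = t *: z + (1 - t) *: x.
    by apply/colP => i; rewrite !mxE; ring.
  exact: Ccvx.
(* [phi] is [f] along the segment minus its quadratic majorant, up to a constant. Cauchy-Schwarz and
   the Lipschitz bound give [dphi <= 0], hence [phi 1 <= phi 0]. *)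
pose phi (t : R) := f (x + t *: h) - (t * dotv (g x) h + t ^+ 2 * (L / 2 * normv h ^+ 2)).
pose dphi (t : R) := dotv (g (x + t *: h)) h - (dotv (g x) h + t * (L * normv h ^+ 2)).
have dp (t : R) : t \in `[0, 1]%R -> is_derive t 1 phi (dphi t).
  move=> /Cl Ct; have dl := is_derive_line _ _ _ fg Ct.
  have d1 : is_derive t 1 (fun t : R => t * dotv (g x) h) (dotv (g x) h).
    by apply: is_derive_eq; rewrite scaler0 add0r /GRing.scale /= mulr1.
  have d2 : is_derive t 1 (fun t : R => t ^+ 2 * (L / 2 * normv h ^+ 2))
      (t * (L * normv h ^+ 2)).
    apply: is_derive_eq; rewrite scaler0 add0r /GRing.scale /=; field; exact: isT.
  exact: (is_deriveB dl (is_deriveD d1 d2)).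
have cphi : {within `[0, 1], continuous phi}.
  by apply: derivable_within_continuous => t /dp [].
have dphi01 (t : R) : t \in `]0, 1[%R -> is_derive t 1 phi (dphi t).
  by move=> t01; apply: dp; exact: subset_itv_oo_cc.
have [c c01] := MVT_segment ler01 dphi01 cphi.
have xh : x + h = z by rewrite /h addrC subrK.
rewrite subr0 mulr1 /phi scale1r scale0r addr0 xh -/h => E.
have c0 : 0 <= c by move: c01; rewrite in_itv => /andP[].
suff : dphi c <= 0 by nra.
rewrite /dphi.
have -> : dotv (g (x + c *: h)) h = dotv (g (x + c *: h) - g x) h + dotv (g x) h.
  by rewrite -dotvDl subrK.
have := dotv_le_normv (g (x + c *: h) - g x) h.
have := gL _ _ (Cl _ c01) Cx.
rewrite addrAC subrr add0r normvZ ger0_norm // => h1.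
have : normv (g (x + c *: h) - g x) * normv h <= L * (c * normv h) * normv h.
  by rewrite ler_wpM2r // normv_ge0.
by nra.
Qed.

(** The induction step of both averaging lemmas below. A general module [V] covers the points [v i]
    as well as the real values [f (v i)]. *)
Lemma meanS (V : lmodType R) (v : nat -> V) k (t := k.+1%:R / k.+2%:R : R) :
  k.+2%:R^-1 *: \sum_(i < k.+2) v i =
  t *: (k.+1%:R^-1 *: \sum_(i < k.+1) v i) + (1 - t) *: v k.+1.
Proof.
rewrite big_ord_recr /= scalerDr scalerA /t -[k.+2%:R]natr1.
by congr (_ *: _ + _ *: _); field; rewrite -?mulrS ?natr1 ?pnatr_eq0.
Qed.

Lemma cvx_mean {C} (v : nat -> 'cV[R]_n) k : cvx_set C ->
  (forall i, C (v i)) -> C (k.+1%:R^-1 *: \sum_(i < k.+1) v i).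
Proof.
move=> Ccvx Cv; elim: k => [|k IHk]; first by rewrite big_ord1 invr1 scale1r.
rewrite meanS; apply: Ccvx => //.
by rewrite divr_ge0 //= ler_pdivrMr ?ltr0Sn // mul1r ler_nat.
Qed.

Lemma cvx_fun_mean_le {C f} (v : nat -> 'cV[R]_n) k : cvx_set C ->
  cvx_fun_on C f -> (forall i, C (v i)) ->
  f (k.+1%:R^-1 *: \sum_(i < k.+1) v i) <= k.+1%:R^-1 * \sum_(i < k.+1) f (v i).
Proof.
move=> Ccvx fcvx Cv; elim: k => [|k IHk].
  by rewrite !big_ord1 invr1 scale1r mul1r.
set t : R := k.+1%:R / k.+2%:R.
have t01 : 0 <= t <= 1.
  by rewrite divr_ge0 //= ler_pdivrMr ?ltr0Sn // mul1r ler_nat.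
have -> : k.+2%:R^-1 * \sum_(i < k.+2) f (v i) =
    t * (k.+1%:R^-1 * \sum_(i < k.+1) f (v i)) + (1 - t) * f (v k.+1).
  exact: (@meanS R^o (f \o v) k).
rewrite meanS -/t; apply: le_trans (fcvx _ _ (cvx_mean _ _ Ccvx Cv) (Cv _) _ t01) _.
by rewrite lerD2r ler_wpM2l //; case/andP: t01.
Qed.

(** A [sup] is an upper bound only when the set is bounded; compactness of [C] ensures this. *)
Lemma normv_le_diam {C} u v : compact C -> C u -> C v -> normv (u - v) <= diam C.
Proof.
move=> cC Cu Cv; apply: ub_le_sup; last by exists u, v.
have [M [_ /(_ (M + 1))]] := compact_bounded cC.
rewrite ltrDl ltr01 => /(_ isT) MC.
exists (n%:R * ((M + 1) + (M + 1))) => _ [a [b [Ca [Cb ->]]]].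
apply: le_trans (normv_le_mx_norm _) _; rewrite ler_wpM2l //.
by apply: le_trans (ler_normB _ _) _; apply: lerD; exact: MC.
Qed.

End convex.

(** * The largest eigenvalue of a Gram matrix *)

Section rayleigh.
Context {R : realType} {l d : nat}.
Variable F : 'M[R]_(l, d).

(* Heine-Borel is available for row vectors only, hence the transpositions. *)
Lemma dotv_mulmx_trmx_continuous {m} (A : 'M[R]_(m, d)) :
  continuous (fun r : 'rV[R]_d => dotv (A *m r^T) (A *m r^T)).
Proof.
have c i : continuous (fun r : 'rV[R]_d => (A *m r^T) i 0 : R).
  under eq_fun do rewrite mxE.
  apply: (continuous_big (op := +%R)) => [|j _]; first exact: add_continuous.
  under eq_fun do rewrite mxE.
  by move=> v; apply: continuousM; [exact: cst_continuous|exact: coord_continuous].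
apply: (continuous_big (op := +%R)) => [|i _]; first exact: add_continuous.
by move=> v; apply: continuousM; exact: c.
Qed.

Let sphere : set 'rV[R]_d := [set r | dotv r^T r^T = 1].

Lemma sphere_compact : compact sphere.
Proof.
apply: bounded_closed_compact.
  exists 1; split; first exact: num_real.
  move=> M M1 r /= r1; apply: le_trans (ltW M1).
  rewrite [leLHS]/Num.norm /= mx_normrE; apply/bigmax_leP; split => //= -[i j] _.
  rewrite /= ord1 (_ : r 0 j = r^T j 0); last by rewrite mxE.
  by apply: le_trans (normr_coord_le_normv _ _) _; rewrite /normv r1 sqrtr1.
have -> : sphere =
    (fun r : 'rV[R]_d => dotv (1%:M *m r^T) (1%:M *m r^T)) @^-1` [set 1 : R].
  by apply/seteqP; split => r /=; rewrite mul1mx.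
apply: closed_comp; last exact: closed_eq.
by move=> r _; exact: dotv_mulmx_trmx_continuous.
Qed.

(** [M] is the maximum of [|F u|^2] over the unit sphere, which is nonempty thanks to [v]; a
    maximiser is an eigenvector by first-order optimality. *)
Lemma rayleigh_max (v : 'cV[R]_d) : v != 0 -> exists M : R, exists v0 : 'cV[R]_d,
  [/\ v0 != 0, F^T *m F *m v0 = M *: v0 &
      forall u, normv (F *m u) ^+ 2 <= M * normv u ^+ 2].
Proof.
move=> vn0.
have sphere_scale (u : 'cV[R]_d) : u != 0 -> sphere ((normv u)^-1 *: u)^T.
  move=> un0; rewrite /sphere /= trmxK !dotvE -sqr_normv expr2.
  have un0' : normv u != 0 by apply: contra un0 => /eqP /normv_eq0 ->.
  by field.
have [||r0 /set_mem r01 r0max] := @compact_EVT_max _ R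
  (fun r : 'rV[R]_d => dotv (F *m r^T) (F *m r^T)) sphere _ sphere_compact.
- by exists ((normv v)^-1 *: v)^T; exact: sphere_scale.
- exact/continuous_subspaceT/dotv_mulmx_trmx_continuous.
pose v0 := r0^T; pose M := dotv (F *m v0) (F *m v0).
have v01 : dotv v0 v0 = 1 by [].
have FM u : normv (F *m u) ^+ 2 <= M * normv u ^+ 2.
  have [->|un0] := eqVneq u 0; first by rewrite mulmx0 !normv0 expr0n mulr0.
  have := r0max _ (mem_set (sphere_scale _ un0)).
  rewrite trmxK -scalemxAr !dotvE -!sqr_normv mulrA -expr2 exprVn.
  have u2 : 0 < normv u ^+ 2.
    by rewrite exprn_gt0 // lt0r normv_ge0 andbT; apply: contra un0 => /eqP /normv_eq0 ->.
  by rewrite ler_pdivrMl // mulrC /M -sqr_normv.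
exists M, v0; split => //.
  by apply: contra_eq_neq v01 => ->; rewrite dotv0 eq_sym oner_neq0.
(* [h] is the eigenvector residual. Moving [v0] by [t h] in the inequality [FM] leaves
   [0 <= - t |h|^2 + O(t^2)], which forces [h = 0]. *)
have [h hE] : exists h, F^T *m F *m v0 = h + M *: v0.
  by exists (F^T *m F *m v0 - M *: v0); rewrite subrK.
rewrite hE -[RHS]add0r; congr (_ + _); apply/dotvv_eq0/eqP.
rewrite eq_le dotvv_ge0 andbT -oppr_ge0.
apply: (@ge0_of_quadratic_ge0 _ _
  ((M * dotv h h - dotv (F *m h) (F *m h)) / 2)) => t t0 t1.
have := FM (v0 + t *: h).
rewrite mulmxDr -scalemxAr !sqr_normv !dotvE -/M v01.
rewrite (dotvC h v0) (dotvC (F *m h)).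
have -> : dotv (F *m v0) (F *m h) = dotv h h + M * dotv v0 h.
  by rewrite dotv_mulmx mulmxA hE !dotvE.
by lra.
Qed.

(** [eigenvalue] refers to row vectors multiplied from the left; the symmetry of the Gram matrix
    turns them into columns. *)
Lemma eigenvalue_gramP a :
  eigenvalue (F^T *m F) a <-> exists2 v : 'cV[R]_d, v != 0 & F^T *m F *m v = a *: v.
Proof.
have FF : (F^T *m F)^T = F^T *m F by rewrite trmx_mul trmxK.
split=> [/eigenvalueP[v vE v0]|[v v0 vE]].
  exists v^T; first by apply: contra v0 => /eqP/(congr1 trmx); rewrite trmxK trmx0 => ->.
  by rewrite -FF -trmx_mul vE linearZ.
apply/eigenvalueP; exists v^T.
  by rewrite -FF -trmx_mul vE linearZ.
by apply: contra v0 => /eqP/(congr1 trmx); rewrite trmxK trmx0 => ->.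
Qed.

(** The Rayleigh maximum [M] is an eigenvalue and an upper bound of all eigenvalues, so the [sup]
    defining [lambda_max] dominates it. *)
Lemma normv_mulmx_le v :
  normv (F *m v) ^+ 2 <= lambda_max (F^T *m F) * normv v ^+ 2.
Proof.
have [->|vn0] := eqVneq v 0; first by rewrite mulmx0 !normv0 expr0n mulr0.
have [M [v0 [v0n0 Mv0 FM]]] := rayleigh_max _ vn0.
apply: le_trans (FM v) _; rewrite ler_wpM2r ?sqr_ge0 //.
apply: ub_le_sup; last by apply/eigenvalue_gramP; exists v0.
exists M => a /eigenvalue_gramP[u un0 uE].
have u2 : 0 < normv u ^+ 2.
  by rewrite exprn_gt0 // lt0r normv_ge0 andbT; apply: contra un0 => /eqP /normv_eq0 ->.
rewrite -(ler_pM2r u2); apply: le_trans (FM u).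
by rewrite !sqr_normv dotv_mulmx mulmxA uE dotvZl.
Qed.

Lemma lambda_max_ge0 : 0 <= lambda_max (F^T *m F).
Proof.
have [[v vn0]|H] := pselect (exists v : 'cV[R]_d, v != 0).
  have := le_trans (sqr_ge0 _) (normv_mulmx_le v); rewrite pmulr_lge0 //.
  by rewrite exprn_gt0 // lt0r normv_ge0 andbT; apply: contra vn0 => /eqP /normv_eq0 ->.
(* Without nonzero vectors there is no eigenvalue, and the [sup] of the empty set is [0]. *)
rewrite /lambda_max (_ : [set a | _] = set0) ?sup0 //.
by rewrite -subset0 => a /eigenvalue_gramP[v v0 _]; apply: H; exists v.
Qed.

(** [|F^T w|^2 = <w, F F^T w> <= |w| sqrt(lam) |F^T w|], and one factor [|F^T w|] cancels. *)
Lemma normv_trmx_mulmx_le w :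
  normv (F^T *m w) <= Num.sqrt (lambda_max (F^T *m F)) * normv w.
Proof.
have [->|n0] := eqVneq (normv (F^T *m w)) 0.
  by rewrite mulr_ge0 ?sqrtr_ge0 ?normv_ge0.
have n1 : 0 < normv (F^T *m w) by rewrite lt0r n0 normv_ge0.
rewrite -(ler_pM2r n1) -expr2 sqr_normv -dotv_mulmx.
apply: le_trans (dotv_le_normv _ _) _.
rewrite [leRHS]mulrAC [leRHS]mulrC ler_wpM2l ?normv_ge0 //.
rewrite -(ler_pXn2r (ltn0Sn 1)) ?nnegrE ?mulr_ge0 ?sqrtr_ge0 ?normv_ge0 //.
by rewrite exprMn (sqr_sqrtr lambda_max_ge0) normv_mulmx_le.
Qed.

End rayleigh.

(** * Measurable vectors *)

Section measurable_vector.
Context {R : realType} {dT : measure_display} {T : measurableType dT}.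

Definition measurable_vec {n : nat} (v : T -> 'cV[R]_n) : Prop :=
  forall i, measurable_fun setT (fun w => v w i 0).

Section fixed_dim.
Context {n : nat}.
Implicit Types u v : T -> 'cV[R]_n.

Lemma measurable_vec_cst (c : 'cV[R]_n) : measurable_vec (fun=> c).
Proof. by move=> i; exact: measurable_cst. Qed.

Lemma measurable_vecD u v : measurable_vec u -> measurable_vec v ->
  measurable_vec (fun w => u w + v w).
Proof.
by move=> mu mv i; under eq_fun do rewrite mxE; exact: measurable_funD.
Qed.

Lemma measurable_vecZ (a : R) v : measurable_vec v ->
  measurable_vec (fun w => a *: v w).
Proof.
move=> mv i; under eq_fun do rewrite mxE.
by apply: measurable_funM => //; exact: measurable_cst.
Qed.

Lemma measurable_vecB u v : measurable_vec u -> measurable_vec v ->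
  measurable_vec (fun w => u w - v w).
Proof.
move=> mu mv; under eq_fun do rewrite -[- _]scaleN1r.
by apply: measurable_vecD => //; exact: measurable_vecZ.
Qed.

Lemma measurable_vec_sum (I : Type) (r : seq I) (v : I -> T -> 'cV[R]_n) :
  (forall i, measurable_vec (v i)) ->
  measurable_vec (fun w => \sum_(i <- r) v i w).
Proof.
move=> mv i; under eq_fun do rewrite summxE.
by apply: measurable_sum => j; exact: mv.
Qed.

Lemma measurable_dotv u v : measurable_vec u -> measurable_vec v ->
  measurable_fun setT (fun w => dotv (u w) (v w)).
Proof. by move=> mu mv; apply: measurable_sum => i; exact: measurable_funM. Qed.

(** An open set is the union of the countably many boxes with rational centres and radii
    [1 / (k + 1)] that it contains. *)
Lemma measurable_vec_open v (U : set 'cV[R]_n) : measurable_vec v -> open U ->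
  measurable (v @^-1` U).
Proof.
move=> mv oU.
pose box (p : 'cV[rat]_n * nat) : set 'cV[R]_n :=
  [set u | forall i, `|u i 0 - ratr (p.1 i 0)| < p.2.+1%:R^-1].
have mbox p : measurable (v @^-1` box p).
  have -> : v @^-1` box p = \bigcap_(i in [set: 'I_n])
      [set w | `|v w i 0 - ratr (p.1 i 0)| < p.2.+1%:R^-1].
    by apply/seteqP; split => [w h i _|w h i]; [exact: h|exact: (h i Logic.I)].
  apply: fin_bigcap_measurable => // i _.
  rewrite -[X in measurable X]setTI -[X in _ `&` X]preimage_true.
  apply: measurable_fun_ltr => //.
  by apply: measurableT_comp => //; apply: measurable_funB.
have -> : v @^-1` U = \bigcup_p
    (if pselect (box p `<=` U) then v @^-1` box p else set0).
  apply/seteqP; split => [w Uw|w [p _]]; last first.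
    by case: pselect => //= pU vw; exact: (pU (v w)).
  have /nbhs_ballP[e /= e0 eU] := oU _ Uw.
  have [k ke] : exists k : nat, k.+1%:R^-1 < e / 2.
    exists (Num.truncn (2 / e)); rewrite invf_plt ?posrE ?divr_gt0 ?ltr0Sn //.
    by rewrite invf_div truncnS_gt.
  have k0 : 0 < (k.+1%:R^-1 : R) by rewrite invr_gt0 ltr0Sn.
  have /choice[q qE] (i : 'I_n) :
      exists q : rat, `|v w i 0 - ratr q| < k.+1%:R^-1.
    have /rat_in_itvoo[q] : v w i 0 - k.+1%:R^-1 < v w i 0 + k.+1%:R^-1.
      by rewrite ltrBlDr -addrA ltrDl addr_gt0.
    rewrite in_itv /= => /andP[q1 q2]; exists q.
    by rewrite ltr_distlC q1 q2.
  exists (\col_i q i, k) => //.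
  case: pselect => [_|[]] /=; first by move=> i; rewrite mxE.
  move=> u ub; apply: eU; split => // i j; rewrite ord1 /ball /=.
  have := ub i; rewrite /= mxE distrC => h.
  rewrite -(subrK (ratr (q i)) (v w i 0)) -addrA (le_lt_trans (ler_normD _ _)) //.
  by rewrite (splitr e) ltrD // (lt_trans _ ke).
apply: countable_bigcupT_measurable; first exact: countableP.
by move=> p; case: pselect => [?|?] //=; exact: mbox.
Qed.

Lemma measurable_continuous_vec v (f : 'cV[R]_n -> R) :
  measurable_vec v -> continuous f -> measurable_fun setT (fun w => f (v w)).
Proof.
move=> mv cf mT; apply: (measurability _ (RGenOInfty.measurableE R)) => //.
move=> _ [_ [a ->] <-]; rewrite setTI.
apply: (@measurable_vec_open v (f @^-1` `]a, +oo[)) => //.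
by apply: open_comp => // x _; exact: cf.
Qed.

End fixed_dim.

Lemma measurable_vec_continuous {m n} (v : T -> 'cV[R]_m) (f : 'cV[R]_m -> 'cV[R]_n) :
  measurable_vec v -> continuous f -> measurable_vec (fun w => f (v w)).
Proof.
move=> mv cf i; apply: (@measurable_continuous_vec _ _ (fun u => f u i 0)) => //.
move=> u; apply: (@continuous_comp _ _ _ f (fun M : 'cV[R]_n => M i 0 : R) u (cf u)).
exact: coord_continuous.
Qed.

Lemma measurable_vec_mulmx {m n} (A : 'M[R]_(m, n)) (v : T -> 'cV[R]_n) :
  measurable_vec v -> measurable_vec (fun w => A *m v w).
Proof.
move=> mv i; under eq_fun do rewrite mxE; apply: measurable_sum => j.
by apply: measurable_funM => //; exact: measurable_cst.
Qed.

End measurable_vector.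

(** * Independence of the past and the next sample *)

Section independence_fubini.
Context {R : realType} {dT d1 d2 : measure_display}.
Context {T : measurableType dT} {T1 : measurableType d1} {T2 : measurableType d2}.
Variable P : probability T R.

(** Independence makes the law of the pair the product of the two laws, and Tonelli then splits the
    integral. *)
Lemma ge0_integral_indep (U : T -> T1) (V : T -> T2) (f : T1 * T2 -> \bar R) :
  measurable_fun setT U -> measurable_fun setT V ->
  (forall A B, measurable A -> measurable B ->
     P (U @^-1` A `&` V @^-1` B) = P (U @^-1` A) * P (V @^-1` B))%E ->
  measurable_fun setT f -> (forall p, 0 <= f p)%E ->
  (\int[P]_w f (U w, V w) = \int[P]_w \int[P]_w' f (U w, V w'))%E.
Proof.
move=> mU mV indep mf f0.
pose mUV := measurable_fun_pair mU mV.
pose X : {mfun T >-> T1} := HB.pack U (isMeasurableFun.Build _ _ _ _ _ mU).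
pose Y : {mfun T >-> T2} := HB.pack V (isMeasurableFun.Build _ _ _ _ _ mV).
pose Z : {mfun T >-> (T1 * T2)%type} :=
  HB.pack (fun w => (U w, V w)) (isMeasurableFun.Build _ _ _ _ _ mUV).
transitivity (\int[distribution P Z]_p f p)%E.
  by rewrite ge0_integral_distribution.
transitivity (\int[distribution P X \x distribution P Y]_p f p)%E.
  apply: eq_measure_integral => A mA _.
  by apply/esym; apply: product_measure_unique.
rewrite fubini_tonelli1 // ge0_integral_distribution //.
- apply: eq_integral => w _ /=; rewrite /fubini_F ge0_integral_distribution //.
  exact: measurableT_comp.
- exact: measurable_fun_fubini_tonelli_F.
- by move=> w; apply: integral_ge0.
Qed.

End independence_fubini.

Section past.
Context {R : realType} {dT dXi : measure_display}.
Context {T : measurableType dT} {Xi : measurableType dXi}.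
Variable xi : nat -> T -> Xi.

(** A pi-system generating the information in samples [0] to [k - 1], exactly those drawn before
    step [k]. *)
Definition cylinders (k : nat) : set (set T) :=
  [set A | exists2 B : nat -> set Xi, (forall j, measurable (B j)) &
     A = \big[setI/setT]_(j <- iota 0 k) (xi j @^-1` B j)].

(* As a type [past k] is [T]; only its measurable sets, those determined by the
   first [k] samples, differ. *)
Definition past (k : nat) := g_sigma_algebraType (cylinders k).

HB.instance Definition _ k := Measurable.on (past k).

Lemma cylindersT k : cylinders k setT.
Proof. by exists (fun=> setT) => //; rewrite big1. Qed.

Lemma cylinders_setI_closed k : setI_closed (cylinders k).
Proof.
move=> _ _ [B mB ->] [C mC ->]; exists (fun j => B j `&` C j).
  by move=> j; exact: measurableI.
by rewrite -big_split.
Qed.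

Lemma cylinders_pre j k (B : set Xi) : (j < k)%N -> measurable B ->
  cylinders k (xi j @^-1` B).
Proof.
move=> jk mB; exists (fun i => if i == j then B else setT).
  by move=> i; case: ifP.
rewrite (bigD1_seq j) ?iota_uniq ?mem_iota //= eqxx big1 ?setIT //.
by move=> i /negbTE ->; rewrite preimage_setT.
Qed.

Lemma measurable_past_xi j k : (j < k)%N ->
  measurable_fun setT (xi j : past k -> Xi).
Proof.
by move=> jk _ B mB; rewrite setTI; apply: sub_sigma_algebra; exact: cylinders_pre.
Qed.

Hypothesis mxi : forall k, measurable_fun setT (xi k).

Lemma cylinders_measurable k : cylinders k `<=` measurable.
Proof.
move=> _ [B mB ->]; elim/big_ind : _ => //; first exact: measurableI.
by move=> j _; rewrite -[X in measurable X]setTI; exact: mxi.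
Qed.

Lemma past_measurable k (A : set T) : <<s cylinders k >> A -> measurable A.
Proof.
apply: smallest_sub; first exact: sigma_algebra_measurable.
exact: cylinders_measurable.
Qed.

Lemma measurable_past_id k : measurable_fun setT (id : T -> past k).
Proof. by move=> _ A mA; rewrite setTI; exact: past_measurable mA. Qed.

Lemma cylinders_le j k : (j <= k)%N -> cylinders j `<=` cylinders k.
Proof.
move=> jk _ [B mB ->].
exists (fun i => if (i < j)%N then B i else setT); first by move=> i; case: ifP.
rewrite -[in RHS](subnKC jk) iotaD big_cat /= add0n [X in _ `&` X]big1_seq.
  by rewrite setIT; apply: eq_big_seq => i; rewrite mem_iota add0n => /andP[_ ->].
by move=> i /=; rewrite mem_iota => /andP[ji _]; rewrite ltnNge ji preimage_setT.
Qed.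

Lemma measurable_past_le j k : (j <= k)%N ->
  measurable_fun setT (id : past k -> past j).
Proof.
move=> jk.
apply: (@measurability _ _ (past k) (past j) setT id (cylinders j) erefl).
move=> _ [A jA <-]; rewrite setTI; apply: sub_sigma_algebra.
exact: cylinders_le jk _ jA.
Qed.

Variable P : probability T R.
Hypothesis indep : mutually_independent P xi.

(** With [B] fixed, both sides are finite measures in [A] that agree on the cylinders, hence on the
    sigma-algebra they generate. *)
Lemma past_indep k (A : set (past k)) (B : set Xi) :
  measurable A -> measurable B ->
  (P (A `&` xi k @^-1` B) = P A * P (xi k @^-1` B))%E.
Proof.
move=> mA mB.
have mxB : measurable (xi k @^-1` B) by rewrite -[X in measurable X]setTI; exact: mxi.
pose r : {nonneg R} := NngNum (fine_ge0 (measure_ge0 P (xi k @^-1` B))).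
have rE : r%:num%:E = P (xi k @^-1` B) by rewrite /= fineK // fin_num_measure.
rewrite muleC -rE.
have := @g_sigma_algebra_measure_unique _ R T (cylinders k)
  (@cylinders_measurable k) (fun=> setT) _ _ (mrestr P mxB) (mscale r P) _ _ _ A mA.
apply => //.
- by move=> _; exact: cylindersT.
- by rewrite bigcup_const.
- exact: cylinders_setI_closed.
- move=> _ [C mC ->]; set D := \big[setI/setT]_(j <- _) _.
  rewrite -[RHS]/(r%:num%:E * P D)%E rE muleC -[LHS]/(P (D `&` _)) /D {D}.
  (* Inserting [B] at index [k] turns the intersection into a cylinder over [k + 1] samples, to
     which mutual independence applies. *)
  pose C' j := if j == k then B else C j.
  have C'E : \big[setI/setT]_(j <- iota 0 k) (xi j @^-1` C j) =
             \big[setI/setT]_(j <- iota 0 k) (xi j @^-1` C' j).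
    apply: eq_big_seq => j; rewrite mem_iota add0n /C' => /andP[_ jk].
    by rewrite ltn_eqF.
  have mC' j : measurable (C' j) by rewrite /C'; case: ifP.
  have C'k : C' k = B by rewrite /C' eqxx.
  have := indep (iota 0 k.+1) C' (iota_uniq _ _) mC'.
  rewrite -addn1 iotaD !big_cat /= !big_seq1 add0n -C'E C'k => ->.
  by rewrite C'E indep // iota_uniq.
- move=> _; rewrite -[X in (X < _)%E]/(P (setT `&` _)) setTI.
  by rewrite ltey_eq fin_num_measure.
Qed.

Hypothesis idist : identically_distributed P xi.

(** Conditioning on the past: the fresh sample is averaged with the past frozen. Equality in law
    replaces it by [xi 0], for which the oracle assumptions are stated. *)
Lemma ge0_integral_past k (f : past k * Xi -> \bar R) :
  measurable_fun setT f -> (forall p, 0 <= f p)%E ->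
  (\int[P]_w f (w, xi k w) = \int[P]_w \int[P]_w' f (w, xi 0%N w'))%E.
Proof.
move=> mf f0.
rewrite (@ge0_integral_indep _ _ _ _ _ _ _ P (id : T -> past k) (xi k) f) //.
- apply: eq_integral => w _.
  pose X : {mfun T >-> Xi} := HB.pack (xi k) (isMeasurableFun.Build _ _ _ _ _ (mxi k)).
  pose Y : {mfun T >-> Xi} :=
    HB.pack (xi 0%N) (isMeasurableFun.Build _ _ _ _ _ (mxi 0%N)).
  have mg : measurable_fun setT (fun z => f (w, z)).
    exact: (measurableT_comp mf (pair1_measurable (w : past k))).
  transitivity (\int[distribution P X]_z f (w, z))%E.
    by rewrite ge0_integral_distribution.
  transitivity (\int[distribution P Y]_z f (w, z))%E.
    by apply: eq_measure_integral => A mA _; exact: idist.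
  by rewrite ge0_integral_distribution.
- exact: measurable_past_id.
- exact: past_indep.
Qed.

(* Measurability on [past k * Xi] makes [phi k] predictable, so that the product
   divided by its bound is a supermartingale. *)
Lemma expectation_prod_le (phi : nat -> T -> Xi -> R) (K : nat -> R) n :
  (forall k w z, 0 <= phi k w z) ->
  (forall k, measurable_fun setT (fun p : past k * Xi => phi k p.1 p.2)) ->
  (forall k w, (\int[P]_w' (phi k w (xi 0%N w'))%:E <= (K k)%:E)%E) ->
  (\int[P]_w (\prod_(k < n) phi k w (xi k w))%:E <= (\prod_(k < n) K k)%:E)%E.
Proof.
move=> phi0 mphi phiK.
have K0 k : 0 <= K k.
  rewrite -lee_fin; apply: le_trans (phiK k point).
  by apply: integral_ge0 => w _; rewrite lee_fin.
pose M m w := \prod_(k < m) phi k w (xi k w).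
have M0 m w : 0 <= M m w by exact: prodr_ge0.
have mM m : measurable_fun setT (M m : past m -> R).
  apply: measurable_prod => i _ /=.
  have h1 : measurable_fun setT (id : past m -> past i).
    by apply: measurable_past_le; rewrite ltnW.
  have h2 := @measurable_past_xi i m (ltn_ord i).
  exact: (measurableT_comp (mphi i) (measurable_fun_pair h1 h2)).
elim: n => [|n IHn].
  under eq_integral do rewrite big_ord0.
  by rewrite big_ord0 integral_cst //= mul1e; exact: probability_le1.
under eq_integral do rewrite big_ord_recr /=.
rewrite big_ord_recr /=.
pose f (p : past n * Xi) := (M n p.1 * phi n p.1 p.2)%:E.
have mf : measurable_fun setT f.
  apply/measurable_EFinP; apply: measurable_funM => //.
  exact: (measurableT_comp (mM n)).
(* The first [n] factors depend on the past only, so averaging over sample [n] bounds the last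
   factor by [K n], uniformly in the past. *)
rewrite [leLHS](@ge0_integral_past n f) //; last first.
  by move=> p; rewrite lee_fin mulr_ge0.
have mMT : measurable_fun setT (M n).
  exact: (measurableT_comp (mM n) (measurable_past_id n)).
apply: (@le_trans _ _ (\int[P]_w ((M n w)%:E * (K n)%:E))%E).
  apply: ge0_le_integral => //.
  - by move=> w _; apply: integral_ge0 => w' _; rewrite lee_fin mulr_ge0.
  - suff h : measurable_fun setT (fun v : past n => \int[P]_w' f (v, xi 0%N w'))%E.
      exact: (measurableT_comp h (measurable_past_id n)).
    pose Y : {mfun T >-> Xi} :=
      HB.pack (xi 0%N) (isMeasurableFun.Build _ _ _ _ _ (mxi 0%N)).
    have -> : (fun v : past n => \int[P]_w' f (v, xi 0%N w'))%E =
        fubini_F (distribution P Y) f.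
      apply/funext => v; rewrite /fubini_F ge0_integral_distribution //.
        exact: (measurableT_comp mf (pair1_measurable (v : past n))).
      by move=> z; rewrite lee_fin mulr_ge0.
    by apply: measurable_fun_fubini_tonelli_F => // p; rewrite lee_fin mulr_ge0.
  - by apply/measurable_EFinP; apply: measurable_funM.
  move=> w _; rewrite /f /=.
  under eq_integral do rewrite EFinM.
  rewrite ge0_integralZl //; first by rewrite lee_wpmul2l // lee_fin.
  - apply/measurable_EFinP.
    have := measurableT_comp (mphi n) (pair1_measurable (w : past n)).
    by move=> h; exact: (measurableT_comp h).
  - by move=> w' _; rewrite lee_fin.
  - by rewrite lee_fin.
under eq_integral do rewrite muleC.
rewrite ge0_integralZl //.
- by rewrite mulrC EFinM lee_wpmul2l ?lee_fin.
- exact/measurable_EFinP.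
- by move=> w _; rewrite lee_fin.
- by rewrite lee_fin.
Qed.

End past.

(** * Exponential moments and tails *)

Section exponential.
Context {R : realType}.
Implicit Types x p v : R.

(** The function [(1 + z + z^2) exp(-z)] has derivative [z (1 - z) exp(-z)], so on [z <= 1] its
    minimum is its value [1] at [0]. *)
Lemma expR_le_quadratic x : x <= 1 -> expR x <= 1 + x + x ^+ 2.
Proof.
move=> x1.
pose g (z : R) := (1 + z + z ^+ 2) * expR (- z).
have dg (z : R) : is_derive z 1 g (z * (1 - z) * expR (- z)).
  apply: is_derive_eq; rewrite /GRing.scale /=; ring.
have cg a b : {within `[a, b], continuous g}.
  by apply: derivable_within_continuous => z _; case: (dg z).
have g0 : g 0 = 1 by rewrite /g oppr0 expR0; ring.
suff : 1 <= g x.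
  by rewrite /g expRN ler_pdivlMr ?expR_gt0 // mul1r.
have [x0|x0] := leP 0 x.
  have [c] := MVT_segment x0 (fun z _ => dg z) (cg _ _).
  rewrite in_itv /= g0 subr0 => /andP[c0 cx] gE.
  suff : 0 <= c * (1 - c) * expR (- c) * x by lra.
  by rewrite !mulr_ge0 ?expR_ge0 //; lra.
have [c] := MVT_segment (ltW x0) (fun z _ => dg z) (cg _ _).
rewrite in_itv /= g0 sub0r => /andP[xc c0] gE.
suff : 0 <= - c * (1 - c) * expR (- c) * - x by lra.
by rewrite !mulr_ge0 ?expR_ge0 //; lra.
Qed.

(** For a centred variable the linear term vanishes in the mean, leaving only the exponential moment
    of the square. *)
Lemma expR_le_Dsqr x : expR x <= x + expR (x ^+ 2).
Proof.
have [x1|x1] := leP x 1.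
  apply: le_trans (expR_le_quadratic _ x1) _.
  by have := expR_ge1Dx (x ^+ 2); lra.
have : expR x <= expR (x ^+ 2) by rewrite ler_expR; nra.
by lra.
Qed.

Lemma expR_le_chord p v : 0 <= p -> p <= 1 ->
  expR (p * v) <= p * expR v + (1 - p).
Proof.
move=> p0 p1.
have h1 := expR_ge1Dx ((1 - p) * v).
have h2 := expR_ge1Dx (- (p * v)).
have e0 := expR_gt0 (p * v).
have E1 : expR v = expR (p * v) * expR ((1 - p) * v).
  by rewrite -expRD; congr expR; ring.
have E2 : 1 = expR (p * v) * expR (- (p * v)) by rewrite -expRD subrr expR0.
have k1 : p * (expR (p * v) * (1 + (1 - p) * v)) <= p * expR v.
  by rewrite ler_wpM2l // E1 ler_pM2l.
have k2 : (1 - p) * (expR (p * v) * (1 + - (p * v))) <= (1 - p) * 1.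
  by rewrite ler_wpM2l ?subr_ge0 // {2}E2 ler_pM2l.
by nra.
Qed.

End exponential.

(** * Moment generating functions of light-tailed variables *)

Section mgf.
Context {R : realType} {dT : measure_display} {T : measurableType dT}.
Variable P : probability T R.
Variable W : T -> R.
Hypothesis mW : measurable_fun setT W.
Hypothesis EW : (\int[P]_w (expR (W w))%:E <= (expR 1)%:E)%E.

(** The chord inequality for [exp] at [W - 1], multiplied by [exp p], is integrated; the mean of
    [exp (W - 1)] is at most [1]. *)
Lemma mgf_scale_le (p : R) : 0 <= p -> p <= 1 ->
  (\int[P]_w (expR (p * W w))%:E <= (expR p)%:E)%E.
Proof.
move=> p0 p1.
pose a := expR (p - 1) * p; pose b := expR p * (1 - p).
have a0 : 0 <= a by rewrite mulr_ge0 ?expR_ge0.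
have b0 : 0 <= b by rewrite mulr_ge0 ?expR_ge0 ?subr_ge0.
have meW : measurable_fun setT (fun w => (expR (W w))%:E).
  by apply/measurable_EFinP; exact: measurableT_comp.
apply: (@le_trans _ _ (\int[P]_w (a%:E * (expR (W w))%:E + b%:E))%E).
  apply: ge0_le_integral => //.
  - apply/measurable_EFinP; apply: measurableT_comp => //.
    by apply: measurable_funM.
  - by apply: emeasurable_funD => //; apply: emeasurable_funM.
  move=> w _; rewrite -EFinM -EFinD lee_fin.
  have -> : p * W w = p + p * (W w - 1) by ring.
  rewrite expRD.
  have -> : a * expR (W w) + b = expR p * (p * expR (W w - 1) + (1 - p)).
    by rewrite /a /b !expRD; ring.
  by rewrite ler_pM2l ?expR_gt0 // expR_le_chord.
rewrite ge0_integralD //; last 2 first.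
- by move=> w _; rewrite mule_ge0 ?lee_fin ?expR_ge0.
- exact: emeasurable_funM.
rewrite ge0_integralZl //.
rewrite integral_cst //= probability_setT mule1.
apply: (@le_trans _ _ (a%:E * (expR 1)%:E + b%:E)%E).
  by rewrite leeD2r // lee_wpmul2l // lee_fin.
rewrite -EFinM -EFinD lee_fin /a /b -mulrA (mulrC p) mulrA -expRD subrK.
by rewrite -mulrDr addrC subrK mulr1.
Qed.

(** Two regimes. For [g <= 1], use [exp z <= z + exp (z^2)] and scaling by [p = g^2]. For [g > 1],
    use [z <= g^2 / 2 + W / 2] and absorb [exp (1 / 2)] into [exp (g^2 / 2)]. *)
Lemma mgf_centered_le (Z : T -> R) (g : R) :
  P.-integrable setT (fun w => (Z w)%:E) ->
  (\int[P]_w (Z w)%:E = 0)%E ->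
  0 <= g -> (forall w, 0 <= W w) -> (forall w, Z w ^+ 2 <= g ^+ 2 * W w) ->
  (\int[P]_w (expR (Z w))%:E <= (expR (g ^+ 2))%:E)%E.
Proof.
move=> iZ Z0 g0 W0 ZW.
have mZ : measurable_fun setT Z by apply/measurable_EFinP; exact: measurable_int iZ.
have meZ : measurable_fun setT (fun w => (expR (Z w))%:E).
  by apply/measurable_EFinP; exact: measurableT_comp.
have mp (p : R) : measurable_fun setT (fun w => (expR (p * W w))%:E).
  by apply/measurable_EFinP; apply: measurableT_comp => //; apply: measurable_funM.
have [g1|g1] := leP g 1.
  have p0 : 0 <= g ^+ 2 by rewrite sqr_ge0.
  have p1 : g ^+ 2 <= 1 by rewrite expr_le1.
  have iE : P.-integrable setT (fun w => (expR (g ^+ 2 * W w))%:E).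
    apply/integrableP; split => //.
    under eq_integral do rewrite gee0_abs ?lee_fin ?expR_ge0 //.
    by apply: le_lt_trans (mgf_scale_le _ p0 p1) _; rewrite ltry.
  have ptw w : expR (Z w) <= Z w + expR (g ^+ 2 * W w).
    apply: le_trans (expR_le_Dsqr _) _.
    by rewrite lerD2l ler_expR.
  apply: (@le_trans _ _ (\int[P]_w ((Z w)%:E + (expR (g ^+ 2 * W w))%:E))%E).
    apply: ge0_le_integral => //.
    - by apply: emeasurable_funD => //; apply/measurable_EFinP.
    - by move=> w _; rewrite -EFinD lee_fin.
  by rewrite integralD // Z0 add0e; exact: mgf_scale_le.
have h0 : 0 <= 2^-1 :> R by rewrite invr_ge0.
have h1 : 2^-1 <= 1 :> R by lra.
apply: (@le_trans _ _ (\int[P]_w ((expR (g ^+ 2 / 2))%:E * (expR (2^-1 * W w))%:E))%E).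
  apply: ge0_le_integral => //.
  - by apply: emeasurable_funM.
  move=> w _; rewrite -EFinM lee_fin -expRD ler_expR.
  have := ZW w; have := W0 w; set z := Z w; set v := W w => v0 zv.
  have q0 : 0 <= g ^+ 2 / 2 + 2^-1 * v by rewrite addr_ge0 ?mulr_ge0 ?sqr_ge0.
  have [z0|/ltW z0] := leP z 0; first exact: le_trans z0 q0.
  rewrite -(ler_pXn2r (ltn0Sn 1)) ?nnegrE //; apply: le_trans zv _.
  by have := sqr_ge0 (g ^+ 2 - v); nra.
rewrite ge0_integralZl // ?lee_fin ?expR_ge0 //.
apply: (@le_trans _ _ ((expR (g ^+ 2 / 2))%:E * (expR 2^-1)%:E)%E).
  by rewrite lee_wpmul2l ?lee_fin ?expR_ge0 // mgf_scale_le.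
by rewrite -EFinM lee_fin -expRD ler_expR; nra.
Qed.

End mgf.

Lemma measurable_gt_set {R : realType} {dT : measure_display}
    {T : measurableType dT} (S : T -> R) (c : R) :
  measurable_fun setT S -> measurable [set w | S w > c]%R.
Proof.
move=> mS; rewrite -[X in measurable X]setTI -[X in _ `&` X]preimage_true.
exact: measurable_fun_ltr.
Qed.

Lemma exp_markov {R : realType} {dT : measure_display} {T : measurableType dT}
    (P : probability T R) (S : T -> R) (a c : R) :
  measurable_fun setT S ->
  (\int[P]_w (expR (S w))%:E <= (expR a)%:E)%E ->
  (P [set w | S w > c]%R <= (expR (a - c))%:E)%E.
Proof.
move=> mS ES.
pose X : {mfun T >-> R} := HB.pack S (isMeasurableFun.Build _ _ _ _ _ mS).
have mge : measurable [set w | c <= S w].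
  rewrite -[X in measurable X]setTI -[X in _ `&` X]preimage_true.
  exact: measurable_fun_ler.
apply: (@le_trans _ _ (P [set w | c <= S w])).
  by apply: le_measure; rewrite ?inE //; [exact: measurable_gt_set|move=> w /= /ltW].
have := @chernoff _ T R P X 1 c ltr01.
rewrite mul1r expRD EFinM => /le_trans; apply.
rewrite lee_wpmul2r ?lee_fin ?expR_ge0 //.
rewrite /mmt_gen_fun unlock; apply: le_trans ES.
by under eq_integral do rewrite /= mulr1.
Qed.

(** * Tail bounds for the two noise sums *)

Section noise_tails.
Context {R : realType} {dT dXi : measure_display}.
Context {T : measurableType dT} {Xi : measurableType dXi}.
Variables (xi : nat -> T -> Xi) (P : probability T R) (d : nat).
Variables (delta : nat -> T -> Xi -> 'cV[R]_d) (sigma : R).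
Hypothesis mxi : forall k, measurable_fun setT (xi k).
Hypothesis indep : mutually_independent P xi.
Hypothesis idist : identically_distributed P xi.
Hypothesis mdelta :
  forall k, measurable_vec (fun p : past xi k * Xi => delta k p.1 p.2).
Hypothesis sigma_gt0 : 0 < sigma.
Hypothesis delta_mean : forall k w i,
  P.-integrable setT (fun w' => (delta k w (xi 0%N w') i 0)%:E) /\
  (\int[P]_w' (delta k w (xi 0%N w') i 0)%:E = 0)%E.
Hypothesis delta_exp : forall k w,
  (\int[P]_w' (expR (normv (delta k w (xi 0%N w')) ^+ 2 / sigma ^+ 2))%:E
     <= (expR 1)%:E)%E.

(** Past and fresh sample are separate arguments of [delta], so that the hypotheses can freeze the
    past and average over the sample; here both come from the same outcome. *)
Let noise k w := delta k w (xi k w).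

Lemma measurable_noise k : measurable_vec (noise k).
Proof.
move=> i.
exact: (measurableT_comp (mdelta k i)
  (measurable_fun_pair (measurable_past_id _ mxi k) (mxi k))).
Qed.

Lemma measurable_delta_section k w :
  measurable_vec (fun w' => delta k w (xi 0%N w')).
Proof.
move=> i.
exact: (measurableT_comp (measurableT_comp (mdelta k i)
  (pair1_measurable (w : past xi k))) (mxi 0%N)).
Qed.

Lemma measurable_noise_dotv (u : nat -> T -> 'cV[R]_d) n :
  (forall k, measurable_vec (u k : past xi k -> _)) ->
  measurable_fun setT (fun w => \sum_(k < n) dotv (noise k w) (u k w)).
Proof.
move=> mu; apply: measurable_sum => k; apply: measurable_dotv.
  exact: measurable_noise.
by move=> i; exact: (measurableT_comp (mu k i) (measurable_past_id _ mxi k)).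
Qed.

Lemma measurable_noise_sqr (p : nat -> R) n :
  measurable_fun setT (fun w => \sum_(k < n) p k * normv (noise k w) ^+ 2).
Proof.
apply: measurable_sum => k; apply: measurable_funM => //.
under eq_fun do rewrite sqr_normv.
by apply: measurable_dotv; exact: measurable_noise.
Qed.

(** Since [p k <= 1], each normalised factor has exponential moment at most [exp (p k)]; these
    multiply, and Markov's inequality leaves [exp (- Om)]. *)
Lemma noise_sqr_tail (p : nat -> R) n (Om : R) :
  (forall k, 0 <= p k <= 1) ->
  (P [set w | \sum_(k < n) p k * normv (noise k w) ^+ 2 >
              sigma ^+ 2 * (\sum_(k < n) p k + Om)]%R <= (expR (- Om))%:E)%E.
Proof.
move=> p01.
have s2 : 0 < sigma ^+ 2 by rewrite exprn_gt0.
pose S w := \sum_(k < n) p k * (normv (noise k w) ^+ 2 / sigma ^+ 2).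
have SE w : S w = (\sum_(k < n) p k * normv (noise k w) ^+ 2) / sigma ^+ 2.
  by rewrite /S mulr_suml; apply: eq_bigr => k _; rewrite mulrA.
have mS : measurable_fun setT S.
  rewrite (funext SE).
  by apply: measurable_funM => //; exact: measurable_noise_sqr.
rewrite (_ : [set w | _]%R = [set w | S w > \sum_(k < n) p k + Om]%R); last first.
  by apply/seteqP; split => w /=; rewrite SE ltr_pdivlMr // mulrC.
have -> : - Om = \sum_(k < n) p k - (\sum_(k < n) p k + Om).
  by rewrite opprD addrA subrr add0r.
apply: exp_markov => //.
under eq_integral do rewrite expR_sum.
rewrite expR_sum.
apply: (@expectation_prod_le R _ _ T Xi xi mxi P indep idist
  (fun k w z => expR (p k * (normv (delta k w z) ^+ 2 / sigma ^+ 2)))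
  (fun k => expR (p k)) n) => [k w z|k|k w].
- exact: expR_ge0.
- apply: measurableT_comp => //; apply: measurable_funM => //.
  apply: measurable_funM => //.
  under eq_fun do rewrite sqr_normv.
  by apply: measurable_dotv; exact: mdelta.
- have /andP[p0 p1] := p01 k.
  apply: mgf_scale_le => //; apply: measurable_funM => //.
  under eq_fun do rewrite sqr_normv.
  by apply: measurable_dotv; exact: measurable_delta_section.
Qed.

Lemma delta_dotv_mean k w (v : 'cV[R]_d) :
  P.-integrable setT (fun w' => (dotv (delta k w (xi 0%N w')) v)%:E) /\
  (\int[P]_w' (dotv (delta k w (xi 0%N w')) v)%:E = 0)%E.
Proof.
have E : (fun w' => (dotv (delta k w (xi 0%N w')) v)%:E) =
  (fun w' => \sum_(i < d) ((v i 0)%:E * (delta k w (xi 0%N w') i 0)%:E))%E.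
  apply/funext => w'; rewrite /dotv -sumEFin; apply: eq_bigr => i _.
  by rewrite -EFinM mulrC.
have iE i : P.-integrable setT
    (fun w' => (v i 0)%:E * (delta k w (xi 0%N w') i 0)%:E)%E.
  by apply: integrableZl => //; have [] := delta_mean k w i.
rewrite E; split; first exact: integrable_sum.
rewrite integral_sum // big1 // => i _.
have [h1 h2] := delta_mean k w i.
by rewrite integralZl // h2 mule0.
Qed.

Lemma noise_dotv_tail (u : nat -> T -> 'cV[R]_d) (c : R) n (Om : R) :
  (forall k, measurable_vec (u k : past xi k -> _)) ->
  (forall k w, normv (u k w) <= c) -> 0 < Om ->
  (P [set w | \sum_(k < n.+1) dotv (noise k w) (u k w) >
              2 * Num.sqrt Om * c * sigma * Num.sqrt n.+1%:R]%R
     <= (expR (- Om))%:E)%E.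
Proof.
move=> mu uc Om0.
have c0 : 0 <= c := le_trans (normv_ge0 _) (uc 0%N point).
have N0 : 0 < n.+1%:R :> R by rewrite ltr0Sn.
have sN : 0 < Num.sqrt (n.+1%:R : R) by rewrite sqrtr_gt0.
(* For [c = 0] the parameter [m] below would be degenerate; then every [u k] is zero and the event
   is empty. *)
have [cE|cn0] := eqVneq c 0.
  rewrite (_ : [set w | _]%R = set0) ?measure0 ?lee_fin ?expR_ge0 //.
  rewrite -subset0 => w /=; rewrite cE mulr0 !mul0r big1 ?ltxx // => k _.
  rewrite (_ : u k w = 0) ?dotv0 //; apply/normv_eq0/eqP.
  by rewrite eq_le normv_ge0 andbT -cE.
have c1 : 0 < c by rewrite lt0r cn0.
(* The optimal Chernoff parameter: with [N = n + 1], it minimises [N (m c sigma)^2] minus [m] times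
   the threshold, and the exponent is [Om - 2 Om]. *)
pose m := Num.sqrt Om / (c * sigma * Num.sqrt n.+1%:R).
have D0 : 0 < c * sigma * Num.sqrt n.+1%:R by rewrite !mulr_gt0.
have m0 : 0 < m by rewrite divr_gt0 // sqrtr_gt0.
pose S w := \sum_(k < n.+1) m * dotv (noise k w) (u k w).
have SE w : S w = m * \sum_(k < n.+1) dotv (noise k w) (u k w).
  by rewrite /S mulr_sumr.
have mS : measurable_fun setT S.
  rewrite (funext SE).
  by apply: measurable_funM => //; exact: measurable_noise_dotv.
have mE : m * (2 * Num.sqrt Om * c * sigma * Num.sqrt n.+1%:R) = 2 * Om.
  rewrite -{2}(sqr_sqrtr (ltW Om0)) /m; field.
  by rewrite !gt_eqF.
rewrite (_ : [set w | _]%R = [set w | S w > 2 * Om]%R); last first.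
  by apply/seteqP; split => w /=; rewrite SE -mE ltr_pM2l.
have -> : - Om = \sum_(k < n.+1) (m * c * sigma) ^+ 2 - 2 * Om.
  rewrite sumr_const card_ord /m.
  have -> : Num.sqrt Om / (c * sigma * Num.sqrt n.+1%:R) * c * sigma
    = Num.sqrt Om / Num.sqrt n.+1%:R.
    by field; rewrite !gt_eqF.
  rewrite exprMn exprVn (sqr_sqrtr (ltW Om0)) (sqr_sqrtr (ltW N0)).
  by rewrite -[X in X - _]mulr_natr mulfVK ?gt_eqF //; lra.
apply: exp_markov => //.
under eq_integral do rewrite expR_sum.
rewrite expR_sum.
apply: (@expectation_prod_le R _ _ T Xi xi mxi P indep idist
  (fun k w z => expR (m * dotv (delta k w z) (u k w)))
  (fun k => expR ((m * c * sigma) ^+ 2)) n.+1) => [k w z|k|k w].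
- exact: expR_ge0.
- apply: measurableT_comp => //; apply: measurable_funM => //.
  apply: measurable_dotv; first exact: mdelta.
  by move=> i; exact: (measurableT_comp (mu k i) measurable_fst).
- have [h1 h2] := delta_dotv_mean k w (u k w).
  apply: (@mgf_centered_le _ _ _ P
    (fun w' => normv (delta k w (xi 0%N w')) ^+ 2 / sigma ^+ 2)).
  + apply: measurable_funM => //.
    under eq_fun do rewrite sqr_normv.
    by apply: measurable_dotv; exact: measurable_delta_section.
  + exact: delta_exp.
  + by under eq_fun do rewrite EFinM; apply: integrableZl.
  + by under eq_integral do rewrite EFinM; rewrite integralZl // h2 mule0.
  + by rewrite (mulr_ge0 (mulr_ge0 (ltW m0) c0) (ltW sigma_gt0)).
  + by move=> w'; rewrite divr_ge0 ?sqr_ge0.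
  + move=> w'; set D := delta _ _ _; set v := u _ _.
    have -> : (m * c * sigma) ^+ 2 * (normv D ^+ 2 / sigma ^+ 2) =
       m ^+ 2 * (normv D * c) ^+ 2 by field; rewrite gt_eqF.
    rewrite exprMn ler_wpM2l ?sqr_ge0 // -real_normK ?num_real //.
    rewrite ler_pXn2r ?nnegrE ?mulr_ge0 ?normv_ge0 //.
    apply: le_trans (normr_dotv_le _ _) _.
    by rewrite ler_wpM2l ?normv_ge0 // uc.
Qed.

End noise_tails.

(** * Pathwise analysis of SPDHG *)

Section scalar_sums.
Context {R : realType}.

(** With [b^2 = c^2 + 1], [1 = (b - c) (b + c) <= 2 b (b - c)]. The [- 1] matters: it pays for
    lower-order terms in both gap bounds. *)
Lemma sum_inv_sqrt_le n :
  \sum_(k < n.+1) (Num.sqrt k.+1%:R)^-1 <= 2 * Num.sqrt n.+1%:R - 1 :> R.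
Proof.
elim: n => [|n IHn]; first by rewrite big_ord1 sqrtr1 invr1; lra.
rewrite big_ord_recr /=.
set b := Num.sqrt n.+2%:R; set c := Num.sqrt n.+1%:R in IHn *.
have b0 : 0 < b by rewrite sqrtr_gt0 ltr0Sn.
have c0 : 0 < c by rewrite sqrtr_gt0 ltr0Sn.
have b2 : b ^+ 2 = c ^+ 2 + 1 by rewrite !sqr_sqrtr ?ler0n // natr1.
suff : b^-1 <= 2 * (b - c) by lra.
rewrite -[leLHS]mul1r ler_pdivrMr //.
have := sqr_ge0 (b - c); nra.
Qed.

(* Summation by parts: the increments of [a] are paid for by the bound on [A]. *)
Lemma sum_weighted_telescope_le (a A : nat -> R) (M : R) n :
  (forall k, 0 <= a k) -> (forall k, a k <= a k.+1) ->
  (forall k, 0 <= A k <= M) ->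
  \sum_(k < n.+1) a k * (A k - A k.+1) <= a n * M.
Proof.
move=> a0 am A01.
suff : \sum_(k < n.+1) a k * (A k - A k.+1) + a n * A n.+1 <= a n * M.
  have /andP[h _] := A01 n.+1; have := mulr_ge0 (a0 n) h; lra.
elim: n => [|n IHn].
  rewrite big_ord1; have /andP[_ h] := A01 0%N.
  have := ler_wpM2l (a0 0%N) h; nra.
rewrite big_ord_recr /=; have /andP[_ h] := A01 n.+1.
have : (a n.+1 - a n) * A n.+1 <= (a n.+1 - a n) * M.
  by rewrite ler_wpM2l // subr_ge0.
by nra.
Qed.

End scalar_sums.

(** * The inequality for a single iteration *)

Section spdhg_step.
Context {R : realType} {d l : nat}.
Variables (X : set 'cV[R]_d) (Y : set 'cV[R]_l) (F : 'M[R]_(l, d)).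
Variables (loss : 'cV[R]_d -> R) (grad : 'cV[R]_d -> 'cV[R]_d) (L s : R).
Hypothesis Xcvx : cvx_set X.
Hypothesis Ycvx : cvx_set Y.
Hypothesis loss_cvx : cvx_fun_on X loss.
Hypothesis loss_grad : has_gradient_on X loss grad.
Hypothesis L0 : 0 <= L.
Hypothesis grad_lip : lipschitz_grad_on X grad L.
Hypothesis s0 : 0 < s.
Variables (ystar : 'cV[R]_l) (xstar : 'cV[R]_d).
Hypothesis Yystar : Y ystar.
Hypothesis Xxstar : X xstar.

(** The primal projection yields [- (a + L) / 2 |x - x'|^2]. The descent lemma consumes the [L]
    part, and the [a] part absorbs [<dl + r, x - x'>]. The drift [r] arises because [y'] is computed
    at [x] rather than at [x']. *)
Lemma spdhg_step_le (a : R) (x x' g : 'cV[R]_d) (y y' : 'cV[R]_l)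
    (dl := g - grad x) (r := F^T *m (y' - ystar)) :
  0 < a -> X x ->
  is_proj Y (y + s *: (F *m x)) y' ->
  is_proj X (x - (a + L)^-1 *: (g + F^T *m y')) x' ->
  saddleP F loss ystar x' - saddleP F loss y' xstar <=
    (a + L) / 2 * (normv (x - xstar) ^+ 2 - normv (x' - xstar) ^+ 2)
    + (2 * s)^-1 * (normv (y - ystar) ^+ 2 - normv (y' - ystar) ^+ 2)
    + dotv dl (xstar - x) + normv (dl + r) ^+ 2 / (2 * a).
Proof.
move=> a0 Xx py px.
have aL0 : 0 < a + L by rewrite ltr_pwDl.
have Xx' := px.1.
have h1 := is_proj_variational Xcvx px Xxstar.
have h2 := is_proj_variational Ycvx py Yystar.
have h3 := descent_lemma _ _ _ Xcvx loss_grad grad_lip Xx Xx'.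
have h4 := convex_gradient_le _ _ Xcvx loss_cvx loss_grad Xx Xxstar.
(* Young's inequality, from the square of [(x - x') - (dl + r) / a]. *)
have h5 : dotv (dl + r) (x - x') - a / 2 * normv (x - x') ^+ 2
    <= normv (dl + r) ^+ 2 / (2 * a).
  have := mulr_ge0 (ltW a0) (sqr_ge0 (normv ((x - x') - a^-1 *: (dl + r)))).
  rewrite (sqr_normvD (x - x')) normvN normvZ dotvNr dotvZr dotvC.
  rewrite exprMn real_normK ?num_real //.
  set A := normv (x - x') ^+ 2; set B := normv (dl + r) ^+ 2.
  set C := dotv _ _.
  have -> : a * (A + 2 * - (a^-1 * C) + a^-1 ^+ 2 * B) = a * A - 2 * C + B / a.
    by field; rewrite gt_eqF.
  have -> : B / (2 * a) = B / a / 2 by field; rewrite gt_eqF.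
  by lra.
have k1 : 0 <= (a + L) / 2 * (normv (x - xstar) ^+ 2 - normv (x' - xstar) ^+ 2
     - normv (x - x') ^+ 2) + dotv (g + F^T *m y') (xstar - x').
  have := mulr_ge0 (ltW aL0) h1.
  set v := g + F^T *m y'.
  have -> : x' - (x - (a + L)^-1 *: v) = (x' - x) + (a + L)^-1 *: v.
    by rewrite opprB addrCA [_ - x]addrC [RHS]addrC.
  rewrite dotvDl dotvZl mulrDr mulrA mulfV ?gt_eqF // mul1r.
  have -> : normv (x - xstar) ^+ 2 - normv (x' - xstar) ^+ 2
     - normv (x - x') ^+ 2 = 2 * dotv (x' - x) (xstar - x').
    rewrite !sqr_normv !dotvE (dotvC xstar x) (dotvC xstar x') (dotvC x' x).
    by ring.
  by lra.
have k2 : 0 <= (2 * s)^-1 * (normv (y - ystar) ^+ 2 - normv (y' - ystar) ^+ 2)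
    - dotv (ystar - y') (F *m x).
  have E : dotv (y' - (y + s *: (F *m x))) (ystar - y')
     = dotv (y' - y) (ystar - y') - s * dotv (ystar - y') (F *m x).
    rewrite opprD addrA (dotvDl (y' - y)) (dotvNl (s *: _)) dotvZl.
    by rewrite (dotvC (F *m x)).
  have Q : normv (y - ystar) ^+ 2 - normv (y' - ystar) ^+ 2
     = 2 * dotv (y' - y) (ystar - y') + normv (y - y') ^+ 2.
    rewrite !sqr_normv !dotvE (dotvC ystar y) (dotvC ystar y') (dotvC y' y).
    by ring.
  rewrite E in h2; rewrite Q.
  have -> : (2 * s)^-1 * (2 * dotv (y' - y) (ystar - y') + normv (y - y') ^+ 2)
      - dotv (ystar - y') (F *m x) =
    (2 * s)^-1 * (2 * (dotv (y' - y) (ystar - y') - s * dotv (ystar - y') (F *m x))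
      + normv (y - y') ^+ 2) by field; rewrite gt_eqF.
  apply: mulr_ge0; first by rewrite invr_ge0 mulr_ge0 // ltW.
  by apply: addr_ge0; [exact: mulr_ge0|exact: sqr_ge0].
rewrite /saddleP.
(* The coupling splits into the two pairings controlled by [k1] and [k2], plus the drift paired with
   [x - x']. *)
have E1 : dotv ystar (F *m x') - dotv y' (F *m xstar) =
   dotv (F^T *m y') (x' - xstar) + dotv (ystar - y') (F *m x)
   + dotv r (x - x').
  rewrite /r mulmxBr !dotvE !dotv_mulmx; ring.
have E2 : dotv (g + F^T *m y') (xstar - x') =
   dotv (grad x) (xstar - x) - dotv (grad x) (x' - x)
   + dotv dl (xstar - x) + dotv dl (x - x') - dotv (F^T *m y') (x' - xstar).
  by rewrite /dl !dotvE; ring.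
have E3 : normv (x' - x) = normv (x - x') by rewrite -normvN opprB.
rewrite dotvDl in h5; rewrite E2 in k1; rewrite E3 in h3.
set n1 := normv (x - x') ^+ 2 in h3 h5 k1 *.
by lra.
Qed.

End spdhg_step.

(** * Summation along one trajectory and comparison with the target bound *)

Section spdhg_path.
Context {R : realType} {d l : nat}.
Variables (X : set 'cV[R]_d) (Y : set 'cV[R]_l) (F : 'M[R]_(l, d)).
Variables (loss : 'cV[R]_d -> R) (grad : 'cV[R]_d -> 'cV[R]_d) (L s : R).
Hypothesis Xcvx : cvx_set X.
Hypothesis Ycvx : cvx_set Y.
Hypothesis Xcpt : compact X.
Hypothesis Ycpt : compact Y.
Hypothesis loss_cvx : cvx_fun_on X loss.
Hypothesis loss_grad : has_gradient_on X loss grad.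
Hypothesis L0 : 0 <= L.
Hypothesis grad_lip : lipschitz_grad_on X grad L.
Hypothesis s0 : 0 < s.
Variables (ystar : 'cV[R]_l) (xstar : 'cV[R]_d).
Hypothesis Yystar : Y ystar.
Hypothesis Xxstar : X xstar.
Variables (x : nat -> 'cV[R]_d) (y : nat -> 'cV[R]_l) (g : nat -> 'cV[R]_d).
Hypothesis Xx : forall k, X (x k).
Hypothesis Yy : forall k, Y (y k).
Let a (k : nat) : R := Num.sqrt k.+1%:R.
Hypothesis y_proj : forall k, is_proj Y (y k + s *: (F *m x k)) (y k.+1).
Hypothesis x_proj : forall k,
  is_proj X (x k - (a k + L)^-1 *: (g k + F^T *m y k.+1)) (x k.+1).

Let dl k := g k - grad (x k).
Let r k := F^T *m (y k.+1 - ystar).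
Let gap t := saddleP F loss ystar (t.+1%:R^-1 *: \sum_(k < t.+1) x k.+1)
  - saddleP F loss (t.+1%:R^-1 *: \sum_(k < t.+1) y k.+1) xstar.

Let a_gt0 k : 0 < a k.
Proof. by rewrite sqrtr_gt0 ltr0Sn. Qed.

(** Jensen's inequality in [x] and affinity in [y] bound the gap of the averages by the average of
    the one-step gaps. *)
Lemma spdhg_gap_le t :
  t.+1%:R * gap t <= (a t + L) / 2 * diam X ^+ 2 + (2 * s)^-1 * diam Y ^+ 2
    + \sum_(k < t.+1) dotv (dl k) (xstar - x k)
    + \sum_(k < t.+1) normv (dl k + r k) ^+ 2 / (2 * a k).
Proof.
have N0 : 0 < t.+1%:R :> R by rewrite ltr0Sn.
have hx : saddleP F loss ystar (t.+1%:R^-1 *: \sum_(k < t.+1) x k.+1) <=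
    t.+1%:R^-1 * \sum_(k < t.+1) saddleP F loss ystar (x k.+1).
  rewrite /saddleP big_split mulrDr /= -scalemxAr dotvZr mulmx_sumr dotv_sumr lerD2r.
  exact: (cvx_fun_mean_le (fun k => x k.+1) t Xcvx loss_cvx).
have hy : saddleP F loss (t.+1%:R^-1 *: \sum_(k < t.+1) y k.+1) xstar =
    t.+1%:R^-1 * \sum_(k < t.+1) saddleP F loss (y k.+1) xstar.
  rewrite /saddleP big_split mulrDr /= dotvC dotvZr dotv_sumr.
  rewrite sumr_const card_ord -[loss xstar *+ _]mulr_natl mulKf ?gt_eqF //.
  by under eq_bigr do rewrite dotvC.
have h : t.+1%:R * gap t <= \sum_(k < t.+1)
    (saddleP F loss ystar (x k.+1) - saddleP F loss (y k.+1) xstar).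
  rewrite sumrB -ler_pdivlMl // mulrBr /gap hy.
  by rewrite lerD2r.
apply: le_trans h _.
apply: (@le_trans _ _ (\sum_(k < t.+1)
   ((a k + L) / 2 * (normv (x k - xstar) ^+ 2 - normv (x k.+1 - xstar) ^+ 2)
    + (2 * s)^-1 * (normv (y k - ystar) ^+ 2 - normv (y k.+1 - ystar) ^+ 2)
    + dotv (dl k) (xstar - x k) + normv (dl k + r k) ^+ 2 / (2 * a k)))).
  apply: ler_sum => k _.
  exact: (@spdhg_step_le R d l X Y F loss grad L s).
(* Summation by parts with the increasing weights [(a k + L) / 2] for the primal distances, and with
   constant weights for the dual ones. *)
rewrite !big_split /= !lerD2r; apply: lerD.
  apply: (sum_weighted_telescope_le (fun k => (a k + L) / 2)
    (fun k => normv (x k - xstar) ^+ 2)) => k.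
  - by rewrite divr_ge0 // addr_ge0 // ltW.
  - by rewrite ler_pM2r ?invr_gt0 // lerD2r ler_sqrt ?ler_nat.
  - by rewrite sqr_ge0 ler_pXn2r ?nnegrE ?normv_ge0 //;
      [exact: normv_le_diam
      |exact: le_trans (normv_ge0 _) (normv_le_diam _ _ Xcpt (Xx k) Xxstar)].
apply: (sum_weighted_telescope_le (fun k => (2 * s)^-1)
    (fun k => normv (y k - ystar) ^+ 2)) => // k.
- by rewrite invr_ge0 mulr_ge0 // ltW.
- by rewrite sqr_ge0 ler_pXn2r ?nnegrE ?normv_ge0 //;
    [exact: normv_le_diam
    |exact: le_trans (normv_ge0 _) (normv_le_diam _ _ Ycpt (Yy k) Yystar)].
Qed.

Variables (sigma Om : R).
Hypothesis Om_gt0 : 0 < Om.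

Let lam := lambda_max (F^T *m F).
Let q := Num.sqrt lam * diam Y.

Lemma normv_dual_drift_le k : normv (r k) <= q.
Proof.
apply: le_trans (normv_trmx_mulmx_le _ _) _.
by rewrite ler_wpM2l ?sqrtr_ge0 //; exact: normv_le_diam.
Qed.

Let bound t :=
    diam Y ^+ 2 / (2 * s * t.+1%:R) + L * diam X ^+ 2 / (2 * t.+1%:R)
    + (diam X ^+ 2 + 2 * lam * diam Y ^+ 2) / Num.sqrt (t.+1%:R)
    + 2 * Num.sqrt Om * diam X * sigma / Num.sqrt (t.+1%:R)
    + (1 + Om) * sigma ^+ 2 / Num.sqrt (t.+1%:R).

(** Multiplying by [t + 1 = a t ^ 2] clears the denominators that depend on [t], so the comparisons
    below are polynomial in [a t]. *)
Let boundE t : t.+1%:R * bound t =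
  (2 * s)^-1 * diam Y ^+ 2 + L / 2 * diam X ^+ 2 +
  (diam X ^+ 2 + 2 * q ^+ 2 + 2 * Num.sqrt Om * diam X * sigma
     + (1 + Om) * sigma ^+ 2) * a t.
Proof.
have N0 : 0 < t.+1%:R :> R by rewrite ltr0Sn.
have aN : a t ^+ 2 = t.+1%:R by rewrite sqr_sqrtr // ltW.
have at0 := a_gt0 t.
have qE : q ^+ 2 = lam * diam Y ^+ 2.
  by rewrite /q exprMn (sqr_sqrtr (lambda_max_ge0 F)).
rewrite qE /bound -/(a t) -aN; move: (a t) at0 => b b0.
by field; rewrite !gt_eqF.
Qed.

Let sum_a_le t : \sum_(k < t.+1) (a k)^-1 <= 2 * a t - 1.
Proof. exact: sum_inv_sqrt_le. Qed.

Let a_ge1 k : 1 <= a k.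
Proof. by rewrite -sqrtr1 ler_sqrt ?ler1n. Qed.

Let sum_drift_le t :
  \sum_(k < t.+1) (a k)^-1 * normv (r k) ^+ 2 <= q ^+ 2 * \sum_(k < t.+1) (a k)^-1.
Proof.
rewrite mulr_sumr; apply: ler_sum => k _; rewrite mulrC.
rewrite ler_wpM2r ?invr_ge0 ?(ltW (a_gt0 k)) //.
have h := normv_dual_drift_le k.
by rewrite ler_pXn2r ?nnegrE ?normv_ge0 // (le_trans (normv_ge0 _) h).
Qed.

(** Here [|dl + r|^2 <= 2 |dl|^2 + 2 |r|^2] is affordable. *)
Lemma gap_le_bound_large t : 1 <= Om ->
  \sum_(k < t.+1) dotv (dl k) (xstar - x k) <=
    2 * Num.sqrt Om * diam X * sigma * a t ->
  \sum_(k < t.+1) (a k)^-1 * normv (dl k) ^+ 2 <=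
    sigma ^+ 2 * (\sum_(k < t.+1) (a k)^-1 + Om) ->
  gap t <= bound t.
Proof.
move=> Om1 h1 h2.
have N0 : 0 < t.+1%:R :> R by rewrite ltr0Sn.
rewrite -(ler_pM2l N0) boundE; apply: le_trans (spdhg_gap_le t) _.
have h3 : \sum_(k < t.+1) normv (dl k + r k) ^+ 2 / (2 * a k) <=
  \sum_(k < t.+1) (a k)^-1 * normv (dl k) ^+ 2 +
  \sum_(k < t.+1) (a k)^-1 * normv (r k) ^+ 2.
  rewrite -big_split; apply: ler_sum => k _ /=.
  rewrite -mulrDr invfM mulrA mulrC ler_pM2l ?invr_gt0 // ler_pdivrMr //.
  rewrite sqr_normvD.
  have := sqr_ge0 (normv (dl k - r k)).
  by rewrite (sqr_normvD (dl k)) normvN dotvNr; lra.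
have h4 := sum_drift_le t; have h5 := sum_a_le t; have h6 := a_ge1 t.
move: h1 h2 h3 h4 h5 h6; rewrite !mulrDl.
move: (\sum_(k < t.+1) dotv _ _) (\sum_(k < t.+1) (a k)^-1 * normv (dl k) ^+ 2).
move: (\sum_(k < t.+1) (a k)^-1 * normv (r k) ^+ 2).
move: (\sum_(k < t.+1) normv (dl k + r k) ^+ 2 / (2 * a k)).
move: (\sum_(k < t.+1) (a k)^-1) (a t) => S at_ A B C D h1 h2 h3 h4 h5 h6.
have k1 : q ^+ 2 * S <= q ^+ 2 * (2 * at_) by rewrite ler_wpM2l ?sqr_ge0 //; lra.
(* [S + Om <= 2 at_ - 1 + Om], and this is at most [(1 + Om) at_] because
   [(at_ - 1) (Om - 1) >= 0]. *)
have k2 : sigma ^+ 2 * (S + Om) <= sigma ^+ 2 * ((1 + Om) * at_).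
  rewrite ler_wpM2l ?sqr_ge0 //.
  have : 0 <= (at_ - 1) * (Om - 1) by rewrite mulr_ge0 // subr_ge0.
  by lra.
have k3 : 0 <= diam X ^+ 2 * at_ by rewrite mulr_ge0 ?sqr_ge0 //; lra.
by lra.
Qed.

(** The square is expanded exactly and its cross term joins the martingale, so only halves of the
    [|dl|^2] and [|r|^2] sums remain. *)
Lemma gap_le_bound_small t : Om <= 1 ->
  \sum_(k < t.+1) dotv (dl k) (xstar - x k + (a k)^-1 *: r k) <=
    2 * Num.sqrt Om * (diam X + q) * sigma * a t ->
  \sum_(k < t.+1) (a k)^-1 * normv (dl k) ^+ 2 <=
    sigma ^+ 2 * (\sum_(k < t.+1) (a k)^-1 + Om) ->
  gap t <= bound t.
Proof.
move=> Om1 h1 h2.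
have N0 : 0 < t.+1%:R :> R by rewrite ltr0Sn.
rewrite -(ler_pM2l N0) boundE; apply: le_trans (spdhg_gap_le t) _.
have h3 : \sum_(k < t.+1) dotv (dl k) (xstar - x k)
    + \sum_(k < t.+1) normv (dl k + r k) ^+ 2 / (2 * a k) =
  \sum_(k < t.+1) dotv (dl k) (xstar - x k + (a k)^-1 *: r k) +
  (\sum_(k < t.+1) (a k)^-1 * normv (dl k) ^+ 2) / 2 +
  (\sum_(k < t.+1) (a k)^-1 * normv (r k) ^+ 2) / 2.
  rewrite !mulr_suml -!big_split; apply: eq_bigr => k _ /=.
  rewrite sqr_normvD (dotvDr _ (xstar - x k)) dotvZr.
  by field; rewrite gt_eqF.
have h4 := sum_drift_le t; have h5 := sum_a_le t; have h6 := a_ge1 t.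
rewrite -addrA h3.
move: h1 h2 h4 h5 h6; rewrite !mulrDl.
move: (\sum_(k < t.+1) dotv _ _) (\sum_(k < t.+1) (a k)^-1 * normv (dl k) ^+ 2).
move: (\sum_(k < t.+1) (a k)^-1 * normv (r k) ^+ 2).
move: (\sum_(k < t.+1) (a k)^-1) (a t) => S at_ A B C h1 h2 h4 h5 h6.
have k1 : q ^+ 2 * S <= q ^+ 2 * (2 * at_) by rewrite ler_wpM2l ?sqr_ge0 //; lra.
have k2 : sigma ^+ 2 * (S + Om) / 2 <= sigma ^+ 2 * (at_ - 2^-1 + Om / 2).
  by rewrite -mulrA ler_wpM2l ?sqr_ge0 //; lra.
have k3 : 0 <= diam X ^+ 2 * at_ by rewrite mulr_ge0 ?sqr_ge0 //; lra.
have at0 : 0 <= at_ by lra.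
(* The price of enlarging the martingale radius by [q]; the saved halves leave room for both
   resulting squares. *)
have k4 : 2 * Num.sqrt Om * q * sigma * at_ <= (q ^+ 2 + Om * sigma ^+ 2) * at_.
  rewrite ler_wpM2r // -{2}(sqr_sqrtr (ltW Om_gt0)).
  by have := sqr_ge0 (q - Num.sqrt Om * sigma); nra.
have k5 : sigma ^+ 2 * (at_ - 2^-1 + Om / 2) <= sigma ^+ 2 * at_.
  by rewrite ler_wpM2l ?sqr_ge0 //; lra.
by lra.
Qed.

End spdhg_path.

(** The oracle is jointly measurable on tuples, which carry the product sigma-algebra;
    coordinatewise measurable vectors are passed through them. *)
Lemma measurable_vec_oracle {R : realType} {d : nat} {dXi dT : measure_display}
    {Xi : measurableType dXi} {T : measurableType dT}
    (G : 'cV[R]_d -> Xi -> 'cV[R]_d) (v : T -> 'cV[R]_d) (z : T -> Xi) :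
  (forall i, measurable_fun setT
     (fun p : d.-tuple R * Xi => G (vec_of_tuple p.1) p.2 i 0)) ->
  measurable_vec v -> measurable_fun setT z ->
  measurable_vec (fun w => G (v w) (z w)).
Proof.
move=> mG mv mz i.
pose tv w := [tuple v w j 0 | j < d].
have mtv : measurable_fun setT tv.
  apply/measurable_fun_tnthP => j.
  rewrite (_ : _ \o _ = fun w => v w j 0) //.
  by apply/funext => w /=; rewrite tnth_mktuple.
have -> : (fun w => G (v w) (z w) i 0) =
    (fun w => G (vec_of_tuple (tv w)) (z w) i 0).
  apply/funext => w; congr (G _ _ i 0).
  by apply/colP => j; rewrite mxE tnth_mktuple.
exact: (measurableT_comp (mG i) (measurable_fun_pair mtv mz)).
Qed.

Theorem theorem2
  (R : realType) (d l : nat)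
  (X : set 'cV[R]_d) (Y : set 'cV[R]_l) (F : 'M[R]_(l, d))
  (loss : 'cV[R]_d -> R) (grad : 'cV[R]_d -> 'cV[R]_d) (L : R)
  (* probability space and i.i.d. samples *)
  (dT dXi : measure_display) (T : measurableType dT) (Xi : measurableType dXi)
  (P : probability T R) (xi : nat -> T -> Xi)
  (* stochastic gradient nabla l(x, xi) and its noise level *)
  (G : 'cV[R]_d -> Xi -> 'cV[R]_d) (sigma : R)
  (* algorithm parameters and iterates *)
  (s : R) (x0 : 'cV[R]_d) (y0 : 'cV[R]_l)
  (x : nat -> T -> 'cV[R]_d) (y : nat -> T -> 'cV[R]_l)
  (* saddle point *)
  (ystar : 'cV[R]_l) (xstar : 'cV[R]_d)
  (Om : R) (t : nat) :
  (* the sets *)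
  X !=set0 -> cvx_set X -> compact X ->
  Y !=set0 -> cvx_set Y -> compact Y ->
  (* the loss *)
  cvx_fun_on X loss -> has_gradient_on X loss grad ->
  0 <= L -> lipschitz_grad_on X grad L ->
  (* the samples: measurable, mutually independent, identically distributed *)
  (forall k, measurable_fun setT (xi k)) ->
  mutually_independent P xi -> identically_distributed P xi ->
  (* the stochastic gradient oracle *)
  (forall i, measurable_fun setT
     (fun p : d.-tuple R * Xi => G (vec_of_tuple p.1) p.2 i 0)) ->
  0 < sigma ->
  (forall z, X z -> forall i,
     P.-integrable setT (fun w => (G z (xi 0%N w) i 0)%:E) /\
     (\int[P]_w (G z (xi 0%N w) i 0)%:E = (grad z i 0)%:E)%E) ->
  (forall z, X z ->
     (\int[P]_w ((normv (G z (xi 0%N w) - grad z)) ^+ 2)%:E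
        <= (sigma ^+ 2)%:E)%E) ->
  (forall z, X z ->
     (\int[P]_w (expR ((normv (G z (xi 0%N w) - grad z)) ^+ 2 / sigma ^+ 2))%:E
        <= (expR 1)%:E)%E) ->
  (* SPDHG with beta^{k+1} = 1/(sqrt(k+1) + L); xi k is the sample xi^{k+1} *)
  0 < s -> X x0 -> Y y0 ->
  (forall w, x 0%N w = x0) -> (forall w, y 0%N w = y0) ->
  (forall k w, is_argmax Y
     (fun v => saddleP F loss v (x k w) - (2 * s)^-1 * (normv (v - y k w)) ^+ 2)
     (y k.+1 w)) ->
  (forall k w, is_proj X
     (x k w - (Num.sqrt (k.+1%:R) + L)^-1 *:
                (G (x k w) (xi k w) + F^T *m y k.+1 w))
     (x k.+1 w)) ->
  (* saddle point *)
  Y ystar -> X xstar ->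
  (forall v z, Y v -> X z ->
     saddleP F loss v xstar <= saddleP F loss ystar xstar /\
     saddleP F loss ystar xstar <= saddleP F loss ystar z) ->
  0 < Om ->
  let Dx := diam X in
  let Dy := diam Y in
  let lam := lambda_max (F^T *m F) in
  let xbar := fun w => (t.+1%:R)^-1 *: \sum_(k < t.+1) x k.+1 w in
  let ybar := fun w => (t.+1%:R)^-1 *: \sum_(k < t.+1) y k.+1 w in
  let bound :=
    Dy ^+ 2 / (2 * s * t.+1%:R) + L * Dx ^+ 2 / (2 * t.+1%:R)
    + (Dx ^+ 2 + 2 * lam * Dy ^+ 2) / Num.sqrt (t.+1%:R)
    + 2 * Num.sqrt Om * Dx * sigma / Num.sqrt (t.+1%:R)
    + (1 + Om) * sigma ^+ 2 / Num.sqrt (t.+1%:R) in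
  (P [set w | (saddleP F loss ystar (xbar w) - saddleP F loss (ybar w) xstar
               > bound)%R]
     <= (2 * expR (- Om))%:E)%E.
Proof.
move=> X0 Xcvx Xcpt Y0 Ycvx Ycpt loss_cvx loss_grad L0 grad_lip mxi indep idist
  mG sigma0 G_mean _ G_exp s0 Xx0 Yy0 x0E y0E y_argmax x_proj Yystar Xxstar _
  Om0.
pose Dx := diam X; pose Dy := diam Y; pose lam := lambda_max (F^T *m F).
pose xbar w := (t.+1%:R)^-1 *: \sum_(k < t.+1) x k.+1 w.
pose ybar w := (t.+1%:R)^-1 *: \sum_(k < t.+1) y k.+1 w.
pose bound :=
  Dy ^+ 2 / (2 * s * t.+1%:R) + L * Dx ^+ 2 / (2 * t.+1%:R)
  + (Dx ^+ 2 + 2 * lam * Dy ^+ 2) / Num.sqrt (t.+1%:R)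
  + 2 * Num.sqrt Om * Dx * sigma / Num.sqrt (t.+1%:R)
  + (1 + Om) * sigma ^+ 2 / Num.sqrt (t.+1%:R).
pose gap w := saddleP F loss ystar (xbar w) - saddleP F loss (ybar w) xstar.
suff : (P [set w | gap w > bound]%R <= (2 * expR (- Om))%:E)%E by [].
pose a (k : nat) : R := Num.sqrt k.+1%:R.
have Xx k w : X (x k w) by case: k => [|k]; [rewrite x0E|case: (x_proj k w)].
have Yy k w : Y (y k w) by case: k => [|k]; [rewrite y0E|case: (y_argmax k w)].
have y_proj k w : is_proj Y (y k w + s *: (F *m x k w)) (y k.+1 w).
  exact: (is_argmax_is_proj _ (loss (x k w)) _ _ _ s0 (y_argmax k w)).
(* A Lipschitz extension of [grad] to the whole space, which makes the gradient at a measurable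
   iterate measurable. *)
pose grad' (z : 'cV[R]_d) := grad (proj_onto X z).
have grad'E k w : grad (x k w) = grad' (x k w) by rewrite /grad' proj_onto_id.
have grad'_cont : continuous grad'.
  apply: (lipschitz_normv_continuous _ _ L0) => z z'.
  have [Xp Xp'] := ((proj_ontoP _ z X0 Xcpt).1, (proj_ontoP _ z' X0 Xcpt).1).
  apply: le_trans (grad_lip _ _ Xp Xp') _; rewrite ler_wpM2l //.
  by apply: (is_proj_nonexpansive Xcvx); exact: proj_ontoP.
have loss'_cont : continuous (loss \o proj_onto X).
  move=> z; apply: continuous_comp; first exact: proj_onto_continuous.
  by apply: differentiable_continuous; case: (loss_grad _ (proj_ontoP _ z X0 Xcpt).1).
(* Predictability of the drift: [y k.+1] is determined by the first [k] samples, before [xi k] is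
   drawn. *)
have my_step k : measurable_vec (x k : past xi k -> _) ->
    measurable_vec (y k : past xi k -> _) ->
    measurable_vec (y k.+1 : past xi k -> _).
  move=> mx my.
  have -> : y k.+1 = fun w => proj_onto Y (y k w + s *: (F *m x k w)).
    by apply/funext => w; apply: (is_proj_unique Ycvx (y_proj k w)); exact: proj_ontoP.
  apply: measurable_vec_continuous; last exact: proj_onto_continuous.
  by apply: measurable_vecD => //; apply: measurable_vecZ; exact: measurable_vec_mulmx.
have mxy k : measurable_vec (x k : past xi k -> _) /\
             measurable_vec (y k : past xi k -> _).
  elim: k => [|k [mx my]].
    by rewrite (funext x0E) (funext y0E); split; exact: measurable_vec_cst.
  have mle := @measurable_past_le _ _ _ _ xi k k.+1 (leqnSn k).
  have lift n (v : T -> 'cV[R]_n) : measurable_vec (v : past xi k -> _) ->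
      measurable_vec (v : past xi k.+1 -> _).
    by move=> mv i; exact: (measurableT_comp (mv i) mle).
  have my1 := lift _ _ (my_step k mx my).
  split => //.
  have -> : x k.+1 = fun w => proj_onto X (x k w - (a k + L)^-1 *:
                (G (x k w) (xi k w) + F^T *m y k.+1 w)).
    by apply/funext => w; apply: (is_proj_unique Xcvx (x_proj k w)); exact: proj_ontoP.
  apply: measurable_vec_continuous; last exact: proj_onto_continuous.
  apply: measurable_vecB; first exact: lift.
  apply: measurable_vecZ; apply: measurable_vecD.
    by apply: measurable_vec_oracle => //; [exact: lift|exact: measurable_past_xi].
  exact: measurable_vec_mulmx.
have mx k := (mxy k).1.
have my1 k := my_step k (mx k) (mxy k).2.
pose delta k w z := G (x k w) z - grad (x k w).
have mdelta k : measurable_vec (fun p : past xi k * Xi => delta k p.1 p.2).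
  have mx1 : measurable_vec (fun p : past xi k * Xi => x k p.1).
    by move=> i; exact: (measurableT_comp (mx k i) measurable_fst).
  apply: measurable_vecB; first exact: measurable_vec_oracle.
  under eq_fun do rewrite grad'E.
  exact: measurable_vec_continuous.
have delta_mean k w i :
  P.-integrable setT (fun w' => (delta k w (xi 0%N w') i 0)%:E) /\
  (\int[P]_w' (delta k w (xi 0%N w') i 0)%:E = 0)%E.
  have [iG EG] := G_mean _ (Xx k w) i.
  have E : (fun w' => (delta k w (xi 0%N w') i 0)%:E) =
     (fun w' => (G (x k w) (xi 0%N w') i 0)%:E - (grad (x k w) i 0)%:E)%E.
    by apply/funext => w'; rewrite /delta !mxE EFinD EFinN.
  have ic : P.-integrable setT (fun=> (grad (x k w) i 0)%:E).
    exact: finite_measure_integrable_cst.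
  rewrite E; split; first exact: integrableB.
  rewrite integralB // EG integral_cst //= probability_setT mule1.
  by rewrite subee.
have delta_exp k w := G_exp _ (Xx k w).
pose r k w := F^T *m (y k.+1 w - ystar).
pose q := Num.sqrt lam * Dy.
(* The martingale direction and its radius for the two regimes of [Om]; [a k >= 1] keeps the scaled
   drift below [q]. *)
pose u k w := if 1 <= Om then xstar - x k w
              else xstar - x k w + (a k)^-1 *: r k w.
pose c := if 1 <= Om then Dx else Dx + q.
have a_ge1 k : 1 <= a k by rewrite -sqrtr1 ler_sqrt ?ler1n.
have rq k w : normv (r k w) <= q.
  exact: (@normv_dual_drift_le _ _ _ Y F Ycpt ystar Yystar (fun k => y k w)).
have q0 : 0 <= q := le_trans (normv_ge0 _) (rq 0%N point).
have uc k w : normv (u k w) <= c.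
  rewrite /u /c; have xD := normv_le_diam _ _ Xcpt Xxstar (Xx k w).
  case: ifP => // _; apply: le_trans (normvD _ _) _; rewrite lerD //.
  rewrite normvZ ger0_norm ?invr_ge0 ?(le_trans ler01) //.
  apply: le_trans (rq k w); rewrite ler_piMl ?normv_ge0 // invf_le1 //.
  exact: lt_le_trans ltr01 _.
have mu k : measurable_vec (u k : past xi k -> _).
  have m1 : measurable_vec (fun w : past xi k => xstar - x k w).
    by apply: measurable_vecB => //; exact: measurable_vec_cst.
  rewrite /u; case: (1 <= Om) => //; apply: measurable_vecD => //.
  apply: measurable_vecZ; apply: measurable_vec_mulmx.
  by apply: measurable_vecB; [exact: my1|exact: measurable_vec_cst].
pose noise k w := delta k w (xi k w).
pose E1 := [set w | \sum_(k < t.+1) dotv (noise k w) (u k w) >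
              2 * Num.sqrt Om * c * sigma * Num.sqrt t.+1%:R]%R.
pose E2 := [set w | \sum_(k < t.+1) (a k)^-1 * normv (noise k w) ^+ 2 >
              sigma ^+ 2 * (\sum_(k < t.+1) (a k)^-1 + Om)]%R.
have PE1 : (P E1 <= (expR (- Om))%:E)%E.
  exact: (@noise_dotv_tail R _ _ T Xi xi P d delta sigma).
have PE2 : (P E2 <= (expR (- Om))%:E)%E.
  apply: (@noise_sqr_tail R _ _ T Xi xi P d delta sigma _ _ _ _ _ _
    (fun k => (a k)^-1)) => // k.
  by rewrite invr_ge0 invf_le1 ?a_ge1 ?(le_trans ler01) ?(lt_le_trans ltr01).
have mE1 : measurable E1.
  by apply: measurable_gt_set; exact: (@measurable_noise_dotv R _ _ T Xi xi d delta).
have mE2 : measurable E2.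
  apply: measurable_gt_set.
  exact: (@measurable_noise_sqr R _ _ T Xi xi d delta mxi mdelta (fun k => (a k)^-1)).
(* Outside both exceptional events the pathwise estimate holds, so the union bound gives the factor
   [2]. *)
have sub : [set w | gap w > bound]%R `<=` E1 `|` E2.
  move=> w /= gw; apply: contrapT => /not_orP[].
  rewrite /E1 /E2 /= => /negP; rewrite -leNgt => h1 /negP; rewrite -leNgt => h2.
  move: gw; rewrite ltNge => /negP; apply; move: h1; rewrite /u /c.
  have [Om1|/ltW Om1] := leP 1 Om => h1.
    exact: (@gap_le_bound_large R d l X Y F loss grad L s Xcvx Ycvx Xcpt Ycpt
      loss_cvx loss_grad L0 grad_lip s0 ystar xstar Yystar Xxstar
      (fun k => x k w) (fun k => y k w) (fun k => G (x k w) (xi k w))).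
  exact: (@gap_le_bound_small R d l X Y F loss grad L s Xcvx Ycvx Xcpt Ycpt
      loss_cvx loss_grad L0 grad_lip s0 ystar xstar Yystar Xxstar
      (fun k => x k w) (fun k => y k w) (fun k => G (x k w) (xi k w))).
have mT n (v : nat -> T -> 'cV[R]_n) k : measurable_vec (v k : past xi k -> _) ->
    measurable_vec (v k).
  by move=> mv i; exact: (measurableT_comp (mv i) (measurable_past_id _ mxi k)).
have mxbar : measurable_vec xbar.
  apply: measurable_vecZ; apply: measurable_vec_sum => k; exact: mT.
have mybar : measurable_vec ybar.
  apply: measurable_vecZ; apply: measurable_vec_sum => k; apply: mT.
  exact: (mxy k.+1).2.
have mgap : measurable_fun setT gap.
  (* The averages stay in [X], so the loss may be replaced by its continuous extension, which gives
     measurability. *)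
  have -> : gap = fun w => (loss \o proj_onto X) (xbar w) + dotv ystar (F *m xbar w)
      - (loss xstar + dotv (ybar w) (F *m xstar)).
    apply/funext => w; rewrite /gap /saddleP /= proj_onto_id //.
    exact: (cvx_mean (fun k => x k.+1 w)).
  apply: measurable_funB; apply: measurable_funD => //.
  - exact: measurable_continuous_vec.
  - by apply: measurable_dotv; [exact: measurable_vec_cst|exact: measurable_vec_mulmx].
  - by apply: measurable_dotv => //; exact: measurable_vec_cst.
apply: (@le_trans _ _ (P (E1 `|` E2))).
  apply: le_measure => //; rewrite inE; first exact: measurable_gt_set.
  exact: measurableU.
apply: (@le_trans _ _ (P E1 + P E2)%E); first exact: measureU2.
rewrite mulr_natl mulr2n EFinD; exact: leeD.
Qed.
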